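(* Let $1\le\nu<\infty$, let $\phi(z)=az+b$ with $0<|a|<1$, $b\in\mathbb{C}$, and let $w(z)=e^{p+qz}$ with $p,q\in\mathbb{C}$. Then: if $\operatorname{Re}p+\operatorname{Re}\left(\frac{qb}{1-a}\right)>0$, the operator $W_{w,\phi}$ is not power-bounded on $\mathcal{F}^\nu$; if $\operatorname{Re}p+\operatorname{Re}\left(\frac{qb}{1-a}\right)-\ln|a|<0$, the operator $W_{w,\phi}$ is power-bounded on $\mathcal{F}^\nu$.
   Context: For $1\le\nu<\infty$, $\mathcal{F}^\nu$ is the space of entire functions $f$ with $\|f\|_\nu:=\left(\frac{\nu}{2\pi}\int_{\mathbb{C}}|f(z)|^\nu e^{-\nu|z|^2/2}\,dm(z)\right)^{1/\nu}<\infty$. $W_{w,\phi}f=w\,(f\circ\phi)$. An operator $T$ is power-bounded if $\sup_{n\ge1}\|T^n\|<\infty$. *)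

(* Defs.v *)
From HB Require Import structures.
From mathcomp Require Import all_boot all_order all_algebra.
From mathcomp Require Import all_classical all_reals all_analysis.
From mathcomp Require Import complex.
Set Implicit Arguments. Unset Strict Implicit. Unset Printing Implicit Defensive.
Import Order.TTheory GRing.Theory Num.Theory.
Import numFieldNormedType.Exports.
Local Open Scope ring_scope.
Local Open Scope classical_set_scope.

Section Fock.
Context {R : realType}.
Local Notation C := R[i].

Definition modC (z : C) : R := ComplexField.Normc.normc z.

Definition cexp (z : C) : C :=
  (expR (complex.Re z))%:C%C * (cos (complex.Im z) +i* sin (complex.Im z))%C.

(* f is entire: complex differentiable at every point of C
   (derivable f z 1 : the difference quotient (f(z+h)-f(z))/h converges as h -> 0) *)
Definition entire (f : C -> C) : Prop := forall z : C, derivable (f : C^o -> C^o) z 1.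

Definition areaC := ((@lebesgue_measure R) \x (@lebesgue_measure R))%E.

Definition fock_norm (nu : R) (f : C -> C) : \bar R :=
  (((nu / (2 * pi))%:E *
    \int[areaC]_xy ((modC (f (xy.1 +i* xy.2)%C)) `^ nu *
                       expR (- nu * (modC (xy.1 +i* xy.2)%C) ^+ 2 / 2))%:E)
    `^ nu^-1)%E.

Definition in_fock (nu : R) (f : C -> C) : Prop :=
  entire f /\ (fock_norm nu f < +oo)%E.

Definition Wcomp (w phi : C -> C) (f : C -> C) : C -> C :=
  fun z => w z * f (phi z).

Definition maps_fock (nu : R) (T : (C -> C) -> (C -> C)) : Prop :=
  forall f, in_fock nu f -> in_fock nu (T f).

Definition op_norm (nu : R) (T : (C -> C) -> (C -> C)) : \bar R :=
  ereal_sup [set fock_norm nu (T f) | f in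
             [set f | in_fock nu f /\ (fock_norm nu f <= 1)%E]].

Definition power_bounded (nu : R) (T : (C -> C) -> (C -> C)) : Prop :=
  maps_fock nu T /\
  exists M : R, forall n : nat, (1 <= n)%N -> (op_norm nu (iter n T) <= M%:E)%E.

End Fock.

(* Main.v *)
(** Around the fixed point [z0 = b / (1 - a)] of [phi] the iterates are explicit:
    [|T^n f (z)| = exp (n s + Re (q_n (z - z0))) |f (z0 + a^n (z - z0))|] with
    [s = Re p + Re (q z0)] and [q_n = q (1 - a^n) / (1 - a)] bounded.  If [s > 0], the
    iterates of a constant are at least [C exp (n s)] on a unit square, so their norms
    blow up.  If [s <= 0], it is enough to know that [|f (z)|] is at most a multiple
    of [exp ((|z| + 4)^2 / 2)] when [f] is in the unit ball: the argument of [f] in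
    [T^n f] is contracted by [|a| < 1], so that [T^n f] is dominated, uniformly in [n], by
    [exp ((1/2 - c) |z|^2)] for some [c > 0], and its norm by a Gaussian integral.

    The pointwise bound is proved with Goursat's theorem on rectangles: applied to the
    difference quotient of [f] at [zeta] it bounds [|f zeta|] by the integral of [|f|]
    over the boundary of a rectangle around [zeta], whose sides are chosen by
    Fubini-Tonelli so that [|f|^nu exp (- nu |z|^2 / 2)] has a controlled integral on
    each of them. *)

Require Import Defs.
From HB Require Import structures.
From mathcomp Require Import all_boot all_order all_algebra.
From mathcomp Require Import all_classical all_reals all_analysis.
From mathcomp Require Import measurable_realfun complex.
From mathcomp Require Import ring lra.
Import Order.TTheory GRing.Theory Num.Theory.
Import numFieldNormedType.Exports.
Set Implicit Arguments. Unset Strict Implicit. Unset Printing Implicit Defensive.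
Local Open Scope ring_scope.
Local Open Scope classical_set_scope.

(** * Complex differentiability *)

Section ComplexBasics.
Context {R : realType}.
Local Notation C := R[i].
Implicit Types z w h : C.

Lemma modC_ge0 z : 0 <= modC z.
Proof. by case: z => x y; exact: sqrtr_ge0. Qed.

Lemma modCM z w : modC (z * w) = modC z * modC w.
Proof. exact: ComplexField.Normc.normcM. Qed.

Lemma modCV z : modC z^-1 = (modC z)^-1.
Proof. exact: ComplexField.Normc.normcV. Qed.

Lemma modCX z n : modC (z ^+ n) = modC z ^+ n.
Proof.
elim: n => [|n IH]; first by rewrite !expr0; exact: ComplexField.Normc.normc1.
by rewrite !exprS modCM IH.
Qed.

Lemma modC_sqr z : modC z ^+ 2 = complex.Re z ^+ 2 + complex.Im z ^+ 2.
Proof. by case: z => x y; rewrite /modC/= sqr_sqrtr// addr_ge0// sqr_ge0. Qed.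

Lemma modCD z w : modC (z + w) <= modC z + modC w.
Proof. exact: le_normcD. Qed.

Lemma modCN z : modC (- z) = modC z.
Proof. exact: normcN. Qed.

Lemma modC0 : modC (0 : C) = 0.
Proof. exact: ComplexField.Normc.normc0. Qed.

Lemma modC0_eq0 z : modC z = 0 -> z = 0.
Proof. exact: ComplexField.Normc.eq0_normc. Qed.

Lemma modC_gt0 z : z != 0 -> 0 < modC z.
Proof.
move=> z0; rewrite lt_neqAle modC_ge0 andbT eq_sym.
by apply: contra z0 => /eqP/modC0_eq0 ->.
Qed.

Lemma normE z : `|z| = (modC z)%:C%C :> C.
Proof. by case: z. Qed.

Lemma normRe_le z : `|complex.Re z| <= modC z.
Proof.
rewrite -(ger0_norm (modC_ge0 z)) -ler_sqr ?nnegrE ?normr_ge0//.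
by rewrite !real_normK ?num_real// modC_sqr lerDl sqr_ge0.
Qed.

Lemma normIm_le z : `|complex.Im z| <= modC z.
Proof.
rewrite -(ger0_norm (modC_ge0 z)) -ler_sqr ?nnegrE ?normr_ge0//.
by rewrite !real_normK ?num_real// modC_sqr lerDr sqr_ge0.
Qed.

Lemma modC_le_add (x y : R) : modC (x +i* y)%C <= `|x| + `|y|.
Proof.
rewrite -(ger0_norm (modC_ge0 _)) -ler_sqr ?nnegrE ?addr_ge0 ?normr_ge0//.
rewrite real_normK ?num_real// modC_sqr/= sqrrD !real_normK ?num_real//.
by rewrite addrAC lerDl mulrn_wge0// mulr_ge0.
Qed.

Lemma modC_real (x : R) : modC x%:C%C = `|x|.
Proof. by rewrite /modC /= expr0n/= addr0 sqrtr_sqr. Qed.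

Lemma modC_dist z w : modC z - modC w <= modC (z - w).
Proof. by rewrite lerBlDr; apply: le_trans (modCD _ _); rewrite subrK. Qed.

Lemma modC_ltr z (e : R) : (`|z| < e%:C%C) = (modC z < e).
Proof. by rewrite normE ltcR. Qed.

(** Complex differentiability in terms of real moduli. The estimate is multiplied through by
    [modC h], so that no division occurs and [h = 0] is no exception. *)
Definition cdiff_at (f : C -> C) z l := forall e : R, 0 < e ->
  exists2 d : R, 0 < d &
    forall h, modC h < d -> modC (f (z + h) - f z - l * h) <= e * modC h.

Lemma derivable_cdiff (f : C -> C) z :
  derivable (f : C^o -> C^o) z 1 <-> exists l, cdiff_at f z l.
Proof.
split.
  move=> /cvg_ex[l /cvgrPdist_lt H]; exists l => e e0.
  have /H : 0 < e%:C%C :> C by rewrite ltcR.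
  rewrite /dnbhs /within/= => /nbhs_ballP[d d0 Hd].
  (* Norms and radii over [C] are themselves elements of [C]; a positive one is real and is replaced
     by its real part. *)
  have dE : d = (complex.Re d)%:C%C by rewrite RRe_real// gtr0_real.
  exists (complex.Re d); first by move: d0; rewrite dE/= ltcR.
  move=> h hd; have [->|h0] := eqVneq h 0.
    by rewrite addr0 subrr mulr0 subrr modC0 mulr0.
  have := Hd h; rewrite /= sub0r normrN dE modC_ltr => /(_ hd h0).
  rewrite modC_ltr => H1.
  rewrite [z + h]addrC.
  have -> : f (h + z) - f z - l * h = - ((l - h^-1 * (f (h + z) - f z)) * h).
    rewrite mulrBl mulrAC mulVf// mul1r; ring.
  rewrite modCN modCM ler_wpM2r ?modC_ge0//.
  by apply: ltW; move: H1; rewrite /GRing.scale/= mulr1.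
move=> [l H]; apply/cvg_ex; exists l; apply/cvgrPdist_lt => e e0.
have eE : e = (complex.Re e)%:C%C by rewrite RRe_real// gtr0_real.
have e20 : 0 < complex.Re e / 2 by move: e0; rewrite eE ltcR => e0; rewrite divr_gt0.
have [d d0 Hd] := H _ e20.
rewrite /dnbhs /within/=; apply/nbhs_ballP; exists d%:C%C; first by rewrite /= ltcR.
move=> h; rewrite /= sub0r normrN modC_ltr => hd h0.
rewrite eE modC_ltr; apply: (@le_lt_trans _ _ (complex.Re e / 2)); last first.
  by move: e20; lra.
have := Hd _ hd; rewrite [z + h]addrC => H1.
rewrite -(ler_pM2r (modC_gt0 h0)); apply: le_trans H1.
rewrite -modCM -modCN /GRing.scale/= mulr1 mulrBl mulrAC mulVf// mul1r.
by rewrite opprB.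
Qed.

Lemma cdiff_eq_near (f g : C -> C) z l (r : R) : 0 < r ->
  (forall h, modC h < r -> f (z + h) = g (z + h)) ->
  cdiff_at f z l -> cdiff_at g z l.
Proof.
move=> r0 fg H e /H[d d0 Hd]; exists (Num.min d r); first by rewrite lt_min d0.
move=> h; rewrite lt_min => /andP[hd hr].
by have := fg 0; rewrite modC0 addr0 => <- //; rewrite -fg//; exact: Hd.
Qed.

Lemma cdiff_affine (f : C -> C) z l a b :
  cdiff_at f (a * z + b) l -> cdiff_at (fun z => f (a * z + b)) z (l * a).
Proof.
move=> H e e0; have [a0|a0] := eqVneq a 0.
  exists 1 => // h _; rewrite a0 !mul0r subrr mulr0 mul0r subrr modC0.
  by rewrite mulr_ge0 ?modC_ge0// ltW.
have ma := modC_gt0 a0.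
have [d d0 Hd] := H _ (divr_gt0 e0 ma).
exists (d / modC a); first exact: divr_gt0.
move=> h; rewrite ltr_pdivlMr// => hd.
have := Hd (a * h); rewrite modCM mulrC => /(_ hd).
have -> : e / modC a * (modC h * modC a) = e * modC h.
  by field; rewrite gt_eqF.
have -> : a * (z + h) + b = a * z + b + a * h by ring.
by rewrite mulrA.
Qed.

Definition ccont (f : C -> C) := forall z (e : R), 0 < e ->
  exists2 d : R, 0 < d & forall h, modC h < d -> modC (f (z + h) - f z) < e.

Lemma cdiff_cont_at (f : C -> C) z l : cdiff_at f z l -> forall e : R, 0 < e ->
  exists2 d : R, 0 < d & forall h, modC h < d -> modC (f (z + h) - f z) < e.
Proof.
move=> H e e0; have [d d0 Hd] := H _ ltr01.
have k0 : 0 < 1 + modC l by rewrite ltr_pwDl// modC_ge0.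
exists (Num.min d (e / (1 + modC l))); first by rewrite lt_min d0 divr_gt0.
move=> h; rewrite lt_min ltr_pdivlMr// => /andP[/Hd hd].
apply: le_lt_trans; rewrite -[f _ - _](subrK (l * h)).
apply: le_trans (modCD _ _) _; rewrite modCM mulrDr mulr1 [modC l * _]mulrC.
by rewrite lerD2r; rewrite mul1r in hd.
Qed.

Lemma cdiff_cont (f : C -> C) : (forall z, exists l, cdiff_at f z l) -> ccont f.
Proof. by move=> H z; have [l] := H z; exact: cdiff_cont_at. Qed.

Lemma entire_cdiff (f : C -> C) : entire f <-> forall z, exists l, cdiff_at f z l.
Proof. by split=> H z; apply/derivable_cdiff; exact: H. Qed.

Lemma cdiffM (f g : C -> C) z l m : cdiff_at f z l -> cdiff_at g z m ->
  exists k, cdiff_at (fun z => f z * g z) z k.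
Proof.
move=> Hf Hg; apply/derivable_cdiff; apply: derivableM; apply/derivable_cdiff.
  by exists l.
by exists m.
Qed.

Lemma cdiffV (f : C -> C) z l : f z != 0 -> cdiff_at f z l ->
  exists k, cdiff_at (fun z => (f z)^-1) z k.
Proof.
by move=> fz0 Hf; apply/derivable_cdiff; apply: derivableV => //;
  apply/derivable_cdiff; exists l.
Qed.

Lemma cdiffD_cst (f : C -> C) z l b :
  cdiff_at f z l -> cdiff_at (fun z => f z + b) z l.
Proof.
move=> H e /H[d d0 Hd]; exists d => // h /Hd.
by rewrite [f z + b]addrC opprD addrA addrK.
Qed.

Lemma ReD z w : complex.Re (z + w) = complex.Re z + complex.Re w.
Proof. by case: z; case: w. Qed.

Lemma ReN z : complex.Re (- z) = - complex.Re z.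
Proof. by case: z. Qed.

Lemma ImD z w : complex.Im (z + w) = complex.Im z + complex.Im w.
Proof. by case: z; case: w. Qed.

Lemma ImN z : complex.Im (- z) = - complex.Im z.
Proof. by case: z. Qed.

Lemma ReM z w : complex.Re (z * w) =
  complex.Re z * complex.Re w - complex.Im z * complex.Im w.
Proof. by case: z; case: w. Qed.

Lemma ImM z w : complex.Im (z * w) =
  complex.Re z * complex.Im w + complex.Im z * complex.Re w.
Proof. by case: z => a b; case: w => c d /=; rewrite mulrC [d * a]mulrC; ring. Qed.

Lemma complex_ext z w : complex.Re z = complex.Re w -> complex.Im z = complex.Im w -> z = w.
Proof. by case: z => a b; case: w => c d /= -> ->. Qed.

Lemma cexp0 : cexp (0 : C) = 1.
Proof. by rewrite /cexp/= expR0 cos0 sin0; apply: complex_ext => /=; ring. Qed.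

Lemma cexpD z w : cexp (z + w) = cexp z * cexp w.
Proof.
rewrite /cexp ReD ImD expRD cosD sinD.
by apply: complex_ext; rewrite !(ReM, ImM)/=; ring.
Qed.

Lemma modC_cexp z : modC (cexp z) = expR (complex.Re z).
Proof.
rewrite /cexp modCM modC_real gtr0_norm ?expR_gt0//.
by rewrite /modC/= cos2Dsin2 sqrtr1 mulr1.
Qed.

(** * The derivative of the complex exponential *)

Lemma derive_small (f : R -> R) df : is_derive (0 : R) 1 f df ->
  forall e : R, 0 < e -> exists2 d : R, 0 < d &
    forall x, `|x| < d -> `|f x - f 0 - df * x| <= e * `|x|.
Proof.
case=> df0 dfE e e0; move: df0; rewrite /derivable => H.
have {}H : (fun h : R => h^-1 *: ((f \o shift 0) (h *: (1:R)) - f 0)) @ 0^' --> df.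
  by rewrite -dfE; exact: H.
move/cvgrPdist_lt : H => /(_ _ e0).
rewrite /dnbhs /within/= => /nbhs_ballP[d d0 Hd].
exists d => // x xd; have [->|x0] := eqVneq x 0.
  by rewrite subrr mulr0 subrr !normr0 mulr0.
have := Hd x; rewrite -ball_normE/= sub0r normrN => /(_ xd x0).
rewrite /GRing.scale/= mulr1 addr0 => H1.
have -> : f x - f 0 - df * x = - ((df - x^-1 * (f x - f 0)) * x) by field.
by rewrite normrN normrM ler_wpM2r// ltW.
Qed.

Lemma cexp_small (e : R) : 0 < e -> exists2 d : R, 0 < d &
    forall h, modC h < d -> modC (cexp h - 1 - h) <= e * modC h.
Proof.
(* The four error terms below are at most [k * |x|], [2 * k * |y|], [4 * k * |y|] and [k * |y|], in
   total at most [8 * k * m]; [k <= 1] keeps [|x|] and [|y|] below 1. *)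
move=> e0; pose k := Num.min (e / 8) 1.
have k0 : 0 < k by rewrite lt_min ltr01 divr_gt0.
have k1 : k <= 1 by rewrite ge_min lexx orbT.
have ke : 8 * k <= e by have : k <= e / 8 by [rewrite ge_min lexx]; lra.
clearbody k; have [d1 d10 H1] := derive_small (is_derive_expR 0) k0.
have [d2 d20 H2] := derive_small (is_derive_sin 0) k0.
have [d3 d30 H3] := derive_small (is_derive_cos 0) k0.
exists (Num.min k (Num.min d1 (Num.min d2 d3))); first by rewrite !lt_min k0 d10 d20.
move=> h; rewrite !lt_min => /and4P[hk h1 h2 h3].
have rh := normRe_le h; have ih := normIm_le h.
have {H1} := H1 _ (le_lt_trans rh h1); have {H2} := H2 _ (le_lt_trans ih h2).
have {H3} := H3 _ (le_lt_trans ih h3).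
rewrite expR0 sin0 cos0 oppr0 mul0r !addr0 !mul1r.
move: (modC h) rh ih hk {h1 h2 h3} => m; case: h => x y.
change (complex.Re (x +i* y)%C) with x; change (complex.Im (x +i* y)%C) with y.
move=> xm ym mk; rewrite subr0 => Hc Hs He.
have -> : cexp (x +i* y)%C - 1 - (x +i* y)%C = (((expR x - 1 - x) * cos y + (1 + x) * (cos y - 1))
   +i* ((expR x - 1) * sin y + (sin y - y)))%C.
  by rewrite /cexp; apply: complex_ext => /=; ring.
apply: le_trans (modC_le_add _ _) _.
have cos1 : `|cos y| <= 1 by rewrite ler_norml cos_geN1 cos_le1.
have ab1 : `|(expR x - 1 - x) * cos y| <= k * `|x|.
  by rewrite normrM -[leRHS]mulr1 ler_pM.
have ab2 : `|(1 + x) * (cos y - 1)| <= 2 * (k * `|y|).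
  rewrite normrM ler_pM//; apply: le_trans (ler_normD _ _) _; rewrite normr1; lra.
have ex1 : `|expR x - 1| <= 2 * k.
  rewrite -[_ - 1](subrK x); apply: le_trans (ler_normD _ _) _.
  have : k * `|x| <= 1 * `|x| by rewrite ler_wpM2r.
  lra.
have sy : `|sin y| <= 2 * `|y|.
  rewrite -[sin y](subrK y); apply: le_trans (ler_normD _ _) _.
  have : k * `|y| <= 1 * `|y| by rewrite ler_wpM2r.
  lra.
have ab3 : `|(expR x - 1) * sin y| <= 2 * k * (2 * `|y|).
  by rewrite normrM ler_pM.
have A1 := ler_normD ((expR x - 1 - x) * cos y) ((1 + x) * (cos y - 1)).
have A2 := ler_normD ((expR x - 1) * sin y) (sin y - y).
have kx : k * `|x| <= k * m by rewrite ler_wpM2l// ltW.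
have ky : k * `|y| <= k * m by rewrite ler_wpM2l// ltW.
have km : 8 * k * m <= e * m by rewrite ler_wpM2r// (le_trans _ xm).
lra.
Qed.

Lemma cdiff_cexp z : cdiff_at (cexp : C -> C) z (cexp z).
Proof.
move=> e e0; have c0 : 0 < modC (cexp z) by rewrite modC_cexp expR_gt0.
have [d d0 Hd] := cexp_small (divr_gt0 e0 c0); exists d => // h /Hd H.
have -> : cexp (z + h) - cexp z - cexp z * h = cexp z * (cexp h - 1 - h).
  by rewrite cexpD; ring.
rewrite modCM mulrC -ler_pdivlMr//; apply: le_trans H _.
by rewrite mulrAC.
Qed.

End ComplexBasics.

(** * Goursat's theorem on rectangles *)

Section SegmentIntegral.
Context {R : realType}.
Implicit Types h k : R -> R.
Local Notation mu := (@lebesgue_measure R).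

(* Unoriented: the value is 0, not the opposite integral, when [b < a]. *)
Definition seg h (a b : R) : R := \int[mu]_(x in `[a, b]) h x.

Lemma seg_integrable h a b : continuous h -> mu.-integrable `[a, b] (EFin \o h).
Proof.
move=> ch; apply: continuous_compact_integrable; first exact: segment_compact.
exact: continuous_subspaceT.
Qed.

Lemma seg_split h a b c : continuous h -> a <= b -> b <= c ->
  seg h a c = seg h a b + seg h b c.
Proof.
move=> ch ab bc; have := @Rintegral_itvB R h (BLeft a) (BRight c) b (seg_integrable _ _ ch).
rewrite !bnd_simp => /(_ ab bc); rewrite Rintegral_itv_obnd_cbnd; last first.
  apply: integrableS (seg_integrable b c ch) => //.
  by apply: subset_itvr; rewrite bnd_simp.
by rewrite /seg => <-; rewrite addrC subrK.
Qed.

Lemma seg_cst (k a b : R) : a <= b -> seg (fun=> k) a b = k * (b - a).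
Proof.
move=> ab; rewrite /seg Rintegral_cst; last exact: measurable_itv.
have E : fine (lebesgue_measure `[a, b]) = b - a.
  rewrite lebesgue_measure_itv/= lte_fin.
  by move: ab; rewrite le_eqVlt => /predU1P[->|->]//; rewrite ltxx subrr.
by congr (_ * _); exact: E.
Qed.

Lemma seg_le h k a b : continuous h -> continuous k ->
  (forall x, a <= x <= b -> h x <= k x) -> seg h a b <= seg k a b.
Proof.
move=> ch ck hk; apply: le_Rintegral; [exact: measurable_itv|exact: seg_integrable|exact: seg_integrable|].
by move=> x /=; rewrite in_itv/=; exact: hk.
Qed.

Lemma segB h k a b : continuous h -> continuous k ->
  seg (fun x => h x - k x) a b = seg h a b - seg k a b.
Proof. by move=> ch ck; rewrite /seg RintegralB//; exact: seg_integrable. Qed.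

Lemma seg_near h (k e a b : R) : continuous h -> a <= b ->
  (forall x, a <= x <= b -> `|h x - k| <= e) ->
  `|seg h a b - k * (b - a)| <= e * (b - a).
Proof.
move=> ch ab H; rewrite ler_distl.
rewrite -mulrBl -mulrDl -!seg_cst//.
have cc (r : R) : continuous (fun _ : R => r) by move=> x; exact: cvg_cst.
by apply/andP; split; apply: seg_le => // x /H; rewrite ler_distl => /andP[].
Qed.

(** The supremum of the left endpoints lies in every interval, because each [v n] bounds all of the
    [u m]. *)
Lemma nested_point (u v : nat -> R) :
  (forall n, u n <= u n.+1) -> (forall n, v n.+1 <= v n) ->
  (forall n, u n <= v n) -> exists c, forall n, u n <= c <= v n.
Proof.
move=> hu hv huv.
have mu_ m n : (m <= n)%N -> u m <= u n.
  by move=> /subnK <-; elim: (n - m)%N => //= k IH; apply: le_trans IH _; rewrite addSn.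
have mv_ m n : (m <= n)%N -> v n <= v m.
  by move=> /subnK <-; elim: (n - m)%N => //= k IH; apply: le_trans IH; rewrite addSn.
have ub n : ubound (range u) (v n).
  move=> _ [m _ <-]; apply: (@le_trans _ _ (u (maxn m n))); first exact/mu_/leq_maxl.
  by apply: le_trans (huv _) _; exact/mv_/leq_maxr.
have hs : has_sup (range u) by split; [exists (u 0%N), 0%N|exists (v 0%N)].
exists (sup (range u)) => n; apply/andP; split.
  by apply: sup_upper_bound => //; exists n.
by apply: ge_sup => //; case: hs.
Qed.

Lemma exp2_small (K d : R) : 0 < d -> exists n : nat, K / 2 ^+ n < d.
Proof.
move=> d0; have [n Hn] : exists n : nat, K / d < n%:R.
  by exists (Num.bound `|K / d|); apply: le_lt_trans (ler_norm _) _; exact: archi_boundP.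
exists n; rewrite ltr_pdivrMr ?exprn_gt0// -ltr_pdivrMl// mulrC.
by apply: lt_trans Hn _; rewrite -natrX ltr_nat ltn_expl.
Qed.

End SegmentIntegral.

Section Goursat.
Context {R : realType}.
Local Notation C := R[i].
Implicit Types g : C -> C.

(** Covers every restriction to a side at once: [p] stands for a real part, an imaginary part or a
    modulus, and [q] for the isometric parametrization of a horizontal or vertical line. *)
Lemma cont_comp_ccont g (p : C -> R) (q : R -> C) : ccont g ->
  (forall z w, `|p z - p w| <= modC (z - w)) ->
  (forall x t, modC (q x - q t) = `|x - t|) -> continuous (fun x => p (g (q x))).
Proof.
move=> cg pB qd t; apply/cvgrPdist_lt => e e0.
have [d d0 H] := cg (q t) e e0; apply/nbhs_ballP; exists d => // x.
rewrite /= => xd; have := H (q x - q t); rewrite qd distrC => /(_ xd).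
rewrite [_ + (_ - _)]addrC subrK => H1.
by rewrite distrC; apply: le_lt_trans H1.
Qed.

Lemma ReB (z w : C) : complex.Re z - complex.Re w = complex.Re (z - w).
Proof. by rewrite ReD ReN. Qed.

Lemma ImB (z w : C) : complex.Im z - complex.Im w = complex.Im (z - w).
Proof. by rewrite ImD ImN. Qed.

Lemma modC_imag (y : R) : modC (0 +i* y)%C = `|y|.
Proof. by rewrite /modC/= expr0n/= add0r sqrtr_sqr. Qed.

Lemma modC_hdist (y x t : R) : modC ((x +i* y) - (t +i* y))%C = `|x - t|.
Proof. by rewrite -modC_real; congr modC; apply: complex_ext => /=; ring. Qed.

Lemma modC_vdist (x y t : R) : modC ((x +i* y) - (x +i* t))%C = `|y - t|.
Proof. by rewrite -modC_imag; congr modC; apply: complex_ext => /=; ring. Qed.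

Definition im_h g y := fun x : R => complex.Im (g (x +i* y)%C).
Definition re_v g x := fun y : R => complex.Re (g (x +i* y)%C).

Lemma cont_im_h g y : ccont g -> continuous (im_h g y).
Proof.
move=> cg; apply: cont_comp_ccont => //; last exact: modC_hdist.
by move=> z w; rewrite ImB normIm_le.
Qed.

Lemma cont_re_v g x : ccont g -> continuous (re_v g x).
Proof.
move=> cg; apply: cont_comp_ccont => //; last exact: modC_vdist.
by move=> z w; rewrite ReB normRe_le.
Qed.

Arguments cont_im_h {g} y cg.
Arguments cont_re_v {g} x cg.

(* Imaginary part of the counterclockwise integral of [g dz]:
   [Im (g dz) = Im g dx + Re g dy]. *)
Definition im_circ g (x1 x2 y1 y2 : R) :=
  seg (im_h g y1) x1 x2 + seg (re_v g x2) y1 y2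
  - seg (im_h g y2) x1 x2 - seg (re_v g x1) y1 y2.

Lemma im_circ_splitx g x1 x2 x3 y1 y2 : ccont g -> x1 <= x2 -> x2 <= x3 ->
  im_circ g x1 x3 y1 y2 = im_circ g x1 x2 y1 y2 + im_circ g x2 x3 y1 y2.
Proof.
move=> cg h1 h2; rewrite /im_circ (seg_split (cont_im_h y1 cg) h1 h2).
by rewrite (seg_split (cont_im_h y2 cg) h1 h2); ring.
Qed.

Lemma im_circ_splity g x1 x2 y1 y2 y3 : ccont g -> y1 <= y2 -> y2 <= y3 ->
  im_circ g x1 x2 y1 y3 = im_circ g x1 x2 y1 y2 + im_circ g x1 x2 y2 y3.
Proof.
move=> cg h1 h2; rewrite /im_circ (seg_split (cont_re_v x1 cg) h1 h2).
by rewrite (seg_split (cont_re_v x2 cg) h1 h2); ring.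
Qed.

(** Up to an error [e * m] the function is affine on the rectangle, and an affine function has
    integral 0 around it. Here [m] is the half perimeter, which bounds the distance from [(cx, cy)]
    to any point of the rectangle. *)
Lemma im_circ_local g l (e d : R) (cx cy x1 x2 y1 y2 : R) : ccont g -> 0 < e ->
  (forall h, modC h < d ->
    modC (g ((cx +i* cy)%C + h) - g (cx +i* cy)%C - l * h) <= e * modC h) ->
  x1 <= cx <= x2 -> y1 <= cy <= y2 -> (x2 - x1) + (y2 - y1) < d ->
  `|im_circ g x1 x2 y1 y2| <= 2 * e * ((x2 - x1) + (y2 - y1)) ^+ 2.
Proof.
move=> cg e0 H /andP[cx1 cx2] /andP[cy1 cy2] hd.
set m := _ + _ in hd *.
set gc := g (cx +i* cy)%C in H.
have key x y : x1 <= x <= x2 -> y1 <= y <= y2 ->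
    `|complex.Im (g (x +i* y)%C) - (complex.Im gc + complex.Re l * (y - cy)
        + complex.Im l * (x - cx))| <= e * m /\
    `|complex.Re (g (x +i* y)%C) - (complex.Re gc + complex.Re l * (x - cx)
        - complex.Im l * (y - cy))| <= e * m.
  move=> /andP[hx1 hx2] /andP[hy1 hy2].
  pose k := (g (x +i* y)%C - gc - l * ((x - cx) +i* (y - cy))%C).
  have hm : modC ((x - cx) +i* (y - cy))%C <= m.
    apply: le_trans (modC_le_add _ _) _; apply: lerD; rewrite ler_norml; lra.
  have hk : modC k <= e * m.
    have := H _ (le_lt_trans hm hd).
    have -> : ((cx +i* cy) + ((x - cx) +i* (y - cy)) = x +i* y)%C.
      by apply: complex_ext => /=; ring.
    by move/le_trans; apply; rewrite ler_wpM2l// ltW.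
  split.
    apply: le_trans hk; apply: le_trans (normIm_le _); rewrite /k.
    case: (g _) => u1 u2; case: (gc) => v1 v2; case: (l) => l1 l2 /=.
    by rewrite le_eqVlt; apply/orP; left; apply/eqP; congr `|_|; ring.
  apply: le_trans hk; apply: le_trans (normRe_le _); rewrite /k.
  case: (g _) => u1 u2; case: (gc) => v1 v2; case: (l) => l1 l2 /=.
  by rewrite le_eqVlt; apply/orP; left; apply/eqP; congr `|_|; ring.
have xx : x1 <= x2 by lra.
have yy : y1 <= y2 by lra.
have y11 : y1 <= y1 <= y2 by lra.
have y22 : y1 <= y2 <= y2 by lra.
have x11 : x1 <= x1 <= x2 by lra.
have x22 : x1 <= x2 <= x2 by lra.
(* In the difference of the two horizontal sides the affine parts leave only [Re l * (y1 - y2)];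
   after integration this is the opposite of what the vertical sides leave. *)
have Hh : `|seg (im_h g y1) x1 x2 - seg (im_h g y2) x1 x2
    - complex.Re l * (y1 - y2) * (x2 - x1)| <= 2 * e * m * (x2 - x1).
  rewrite -segB; [|exact: cont_im_h|exact: cont_im_h].
  apply: seg_near => //.
    by move=> x; apply: cvgB; exact: cont_im_h.
  move=> x hx; rewrite /im_h.
  have [/[swap] _] := key _ _ hx y11; have [/[swap] _] := key _ _ hx y22.
  by rewrite !ler_norml; lra.
have Hv : `|seg (re_v g x2) y1 y2 - seg (re_v g x1) y1 y2
    - complex.Re l * (x2 - x1) * (y2 - y1)| <= 2 * e * m * (y2 - y1).
  rewrite -segB; [|exact: cont_re_v|exact: cont_re_v].
  apply: seg_near => //.
    by move=> y; apply: cvgB; exact: cont_re_v.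
  move=> y hy; rewrite /re_v.
  have [_] := key _ _ x22 hy; have [_] := key _ _ x11 hy.
  by rewrite !ler_norml; lra.
have := lerD Hh Hv; move/(le_trans (ler_normD _ _)).
have -> : 2 * e * m * (x2 - x1) + 2 * e * m * (y2 - y1) = 2 * e * m ^+ 2.
  by rewrite /m; ring.
apply: le_trans.
by rewrite le_eqVlt; apply/orP; left; apply/eqP; congr `|_|; rewrite /im_circ; ring.
Qed.

(** * Successive quartering of a rectangle *)

Section Bisection.
Variables (g : C -> C) (X Y : R) (x0 y0 : R).
Hypotheses (cg : ccont g) (X0 : 0 <= X) (Y0 : 0 <= Y).

(** A rectangle of generation [n] is coded by its lower left corner alone, since its sides [w n] and
    [v n] depend only on [n]. *)
Let w n := X / 2 ^+ n.
Let v n := Y / 2 ^+ n.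
Let I n (s : R * R) := im_circ g s.1 (s.1 + w n) s.2 (s.2 + v n).
Let eta := `|I 0 (x0, y0)|.

(* Moves to a quadrant on which the integral is at least a quarter of the previous one. *)
Definition bisect_step n (s : R * R) : R * R :=
  let t := eta / 4 ^+ n.+1 in
  let s1 := (s.1 + w n.+1, s.2) in
  let s2 := (s.1, s.2 + v n.+1) in
  let s3 := (s.1 + w n.+1, s.2 + v n.+1) in
  if t <= `|I n.+1 s| then s else if t <= `|I n.+1 s1| then s1
  else if t <= `|I n.+1 s2| then s2 else s3.

Fixpoint bisect n := if n is n'.+1 then bisect_step n' (bisect n') else (x0, y0).

Let wS n : w n = w n.+1 + w n.+1.
Proof. by rewrite /w exprS; field; rewrite expf_neq0. Qed.

Let vS n : v n = v n.+1 + v n.+1.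
Proof. by rewrite /v exprS; field; rewrite expf_neq0. Qed.

Let w_ge0 n : 0 <= w n.
Proof. by rewrite divr_ge0// exprn_ge0. Qed.

Let v_ge0 n : 0 <= v n.
Proof. by rewrite divr_ge0// exprn_ge0. Qed.

Let bisect_large n : eta / 4 ^+ n <= `|I n (bisect n)|.
Proof.
elim: n => [|n IH]; first by rewrite expr0 divr1.
move: IH => /=; move: (bisect n) => [x y] IH; rewrite /bisect_step/=.
set t := eta / 4 ^+ n.+1.
case: (leP t `|I n.+1 (x, y)|) => // h0.
case: (leP t `|I n.+1 (x + w n.+1, y)|) => // h1.
case: (leP t `|I n.+1 (x, y + v n.+1)|) => // h2.
(* The fourth quadrant is chosen without a test. If its integral were also below [t], the integral
   around the whole, a sum of four, would be below [4 * t = eta / 4 ^+ n]. *)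
rewrite leNgt; apply/negP => h3; move: IH; apply/negP; rewrite -ltNge.
have E : I n (x, y) = I n.+1 (x, y) + I n.+1 (x + w n.+1, y)
    + I n.+1 (x, y + v n.+1) + I n.+1 (x + w n.+1, y + v n.+1).
  rewrite /I/= wS vS [x + (_ + _)]addrA [y + (_ + _)]addrA.
  have a1 : x <= x + w n.+1 by rewrite lerDl.
  have a2 : x + w n.+1 <= x + w n.+1 + w n.+1 by rewrite lerDl.
  have b1 : y <= y + v n.+1 by rewrite lerDl.
  have b2 : y + v n.+1 <= y + v n.+1 + v n.+1 by rewrite lerDl.
  rewrite (im_circ_splitx _ _ cg a1 a2) !(im_circ_splity _ _ cg b1 b2); ring.
have E4 : eta / 4 ^+ n = 4 * t.
  by rewrite /t; rewrite exprS; field; rewrite expf_neq0.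
rewrite E E4.
have := ler_normD (I n.+1 (x, y) + I n.+1 (x + w n.+1, y) + I n.+1 (x, y + v n.+1))
  (I n.+1 (x + w n.+1, y + v n.+1)).
have := ler_normD (I n.+1 (x, y) + I n.+1 (x + w n.+1, y)) (I n.+1 (x, y + v n.+1)).
have := ler_normD (I n.+1 (x, y)) (I n.+1 (x + w n.+1, y)).
by move: h0 h1 h2 h3; lra.
Qed.

Let bisect_x n : (bisect n).1 <= (bisect n.+1).1 <= (bisect n).1 + w n.+1.
Proof.
move=> /=; rewrite /bisect_step; have := w_ge0 n.+1.
by do ?case: ifP => _ /=; move=> h; apply/andP; split; lra.
Qed.

Let bisect_y n : (bisect n).2 <= (bisect n.+1).2 <= (bisect n).2 + v n.+1.
Proof.
move=> /=; rewrite /bisect_step; have := v_ge0 n.+1.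
by do ?case: ifP => _ /=; move=> h; apply/andP; split; lra.
Qed.

(** The nested rectangles shrink to a point where [g] is differentiable. There the local estimate is
    [2 * e * (X + Y) ^+ 2 / 4 ^+ n], which for small [e] contradicts the lower bound
    [eta / 4 ^+ n]. *)
Lemma goursat_aux : (forall x y, x0 <= x <= x0 + X -> y0 <= y <= y0 + Y ->
    exists l, cdiff_at g (x +i* y)%C l) ->
  im_circ g x0 (x0 + X) y0 (y0 + Y) = 0.
Proof.
move=> dg; apply/eqP; rewrite -normr_eq0.
have -> : `|im_circ g x0 (x0 + X) y0 (y0 + Y)| = eta.
  by rewrite /eta /I /w /v/= expr0 !divr1.
rewrite eq_le normr_ge0 andbT leNgt; apply/negP => eta0.
have [cx Hx] : exists c, forall n, (bisect n).1 <= c <= (bisect n).1 + w n.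
  apply: nested_point => n; first by case/andP: (bisect_x n).
    by have /andP[] := bisect_x n; rewrite (wS n); lra.
  by rewrite lerDl.
have [cy Hy] : exists c, forall n, (bisect n).2 <= c <= (bisect n).2 + v n.
  apply: nested_point => n; first by case/andP: (bisect_y n).
    by have /andP[] := bisect_y n; rewrite (vS n); lra.
  by rewrite lerDl.
have [l Hl] : exists l, cdiff_at g (cx +i* cy)%C l.
  apply: dg; [have := Hx 0%N|have := Hy 0%N];
  by rewrite /w /v/= expr0 divr1.
(* The choice of [K] makes [2 * e * (X + Y) ^+ 2] smaller than [eta]; the added 1 keeps [K] positive
   for a degenerate rectangle. *)
pose K := (X + Y) ^+ 2 + 1.
have K0 : 0 < K by rewrite ltr_wpDl// sqr_ge0.
pose e := eta / (4 * K).
have e0 : 0 < e by rewrite divr_gt0// mulr_gt0.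
have [d d0 Hd] := Hl _ e0.
have [n Hn] := exp2_small (X + Y) d0.
have := bisect_large n; apply/negP; rewrite -ltNge.
have wv : w n + v n = (X + Y) / 2 ^+ n by rewrite /w /v mulrDl.
have := @im_circ_local g l e d cx cy _ _ _ _ cg e0 Hd (Hx n) (Hy n).
rewrite ![_ + w n - _]addrAC ![_ + v n - _]addrAC !subrr !add0r wv => /(_ Hn).
move/le_lt_trans; apply.
rewrite exprMn exprVn -exprM mulnC exprM -[2 ^+ 2]natrX mulrA ltr_pM2r; last first.
  by rewrite invr_gt0 exprn_gt0.
have -> : 2 * e * (X + Y) ^+ 2 = eta * ((X + Y) ^+ 2 / (2 * K)).
  by rewrite /e; field; rewrite gt_eqF.
rewrite gtr_pMr// ltr_pdivrMr ?mulr_gt0// mul1r /K.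
by have := sqr_ge0 (X + Y); lra.
Qed.

End Bisection.

Lemma goursat g x1 x2 y1 y2 : ccont g -> x1 <= x2 -> y1 <= y2 ->
  (forall x y, x1 <= x <= x2 -> y1 <= y <= y2 -> exists l, cdiff_at g (x +i* y)%C l) ->
  im_circ g x1 x2 y1 y2 = 0.
Proof.
move=> cg hx hy H; have := @goursat_aux g (x2 - x1) (y2 - y1) x1 y1 cg.
rewrite ![_ + (_ - _)]addrC !subrK; apply => //; by rewrite subr_ge0.
Qed.

Lemma seg_bound (h : R -> R) (B a b : R) : continuous h -> a <= b ->
  (forall x, a <= x <= b -> `|h x| <= B) -> `|seg h a b| <= B * (b - a).
Proof.
move=> ch ab H; have := @seg_near R h 0 B a b ch ab.
by rewrite mul0r subr0; apply => x /H; rewrite subr0.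
Qed.

(** Cutting off four rectangles that avoid the exceptional point, where the integral is 0 by
    [goursat], leaves a square of side [2 * t] around it. There [g] is bounded by continuity, so the
    integral is of order [t]. *)
Lemma goursat_punctured g cx cy x1 x2 y1 y2 : ccont g ->
  x1 < cx < x2 -> y1 < cy < y2 ->
  (forall z, z != (cx +i* cy)%C -> exists l, cdiff_at g z l) ->
  im_circ g x1 x2 y1 y2 = 0.
Proof.
move=> cg /andP[hx1 hx2] /andP[hy1 hy2] dg.
have neq x y : x != cx \/ y != cy -> (x +i* y)%C != (cx +i* cy)%C.
  by move=> H; apply/negP => /eqP[ex ey]; case: H; rewrite ?ex ?ey eqxx.
have [d d0 Hd] := cg (cx +i* cy)%C 1 ltr01.
pose B := modC (g (cx +i* cy)%C) + 1.
have B0 : 0 < B by rewrite ltr_wpDl// modC_ge0.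
have Bg x y : `|x - cx| < d / 2 -> `|y - cy| < d / 2 -> modC (g (x +i* y)%C) <= B.
  move=> hx hy; have := Hd ((x - cx) +i* (y - cy))%C.
  have -> : ((cx +i* cy) + ((x - cx) +i* (y - cy)) = x +i* y)%C.
    by apply: complex_ext => /=; ring.
  move=> H; have /H : modC ((x - cx) +i* (y - cy))%C < d.
    by apply: le_lt_trans (modC_le_add _ _) _; lra.
  by have := modC_dist (g (x +i* y)%C) (g (cx +i* cy)%C); rewrite /B; lra.
suff small e : 0 < e -> `|im_circ g x1 x2 y1 y2| <= e.
  apply/eqP; rewrite -normr_eq0 eq_le normr_ge0 andbT leNgt; apply/negP => H.
  have := small (`|im_circ g x1 x2 y1 y2| / 2); rewrite divr_gt0// => /(_ isT).
  by move: H; lra.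
move=> e0.
(* [d / 4] keeps the square where [modC g <= B], [e / (8 * B)] makes the perimeter times [B] at most
   [e], and the remaining terms keep the square inside the rectangle. *)
pose t := Num.min (Num.min (d / 4) (e / (8 * B))) (Num.min (Num.min (cx - x1) (x2 - cx)) (Num.min (cy - y1) (y2 - cy))).
have t0 : 0 < t by rewrite !lt_min !divr_gt0//= ?mulr_gt0//= !subr_gt0 hx1 hx2 hy1.
have : t <= t by []; rewrite {2}/t !le_min => /and3P[/andP[td te] /andP[tx1 tx2] /andP[ty1 ty2]].
have {}te : 8 * B * t <= e by rewrite mulrC -ler_pdivlMr ?mulr_gt0.
clearbody t B.
have E : im_circ g x1 x2 y1 y2 = im_circ g (cx - t) (cx + t) (cy - t) (cy + t).
  rewrite (@im_circ_splitx g x1 (cx - t) x2)//; [|lra..].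
  rewrite (@im_circ_splitx g (cx - t) (cx + t) x2)//; [|lra..].
  rewrite (@im_circ_splity g (cx - t) (cx + t) y1 (cy - t) y2)//; [|lra..].
  rewrite (@im_circ_splity g (cx - t) (cx + t) (cy - t) (cy + t) y2)//; [|lra..].
  rewrite (@goursat g x1 (cx - t))//; [|lra..|]; last first.
    by move=> x y hx hy; apply: dg; apply: neq; left; apply/negP => /eqP xc; lra.
  rewrite (@goursat g (cx + t) x2)//; [|lra..|]; last first.
    by move=> x y hx hy; apply: dg; apply: neq; left; apply/negP => /eqP xc; lra.
  rewrite (@goursat g (cx - t) (cx + t) y1)//; [|lra..|]; last first.
    by move=> x y hx hy; apply: dg; apply: neq; right; apply/negP => /eqP xc; lra.
  rewrite (@goursat g (cx - t) (cx + t) (cy + t))//; [|lra..|]; last first.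
    by move=> x y hx hy; apply: dg; apply: neq; right; apply/negP => /eqP xc; lra.
  ring.
rewrite E /im_circ; apply: le_trans te.
have hxt : cx - t <= cx + t by lra.
have hyt : cy - t <= cy + t by lra.
have Sh y : `|y - cy| <= t -> `|seg (im_h g y) (cx - t) (cx + t)| <= 2 * B * t.
  move=> hy; apply: le_trans (@seg_bound _ B _ _ (cont_im_h y cg) hxt _) _; last lra.
  move=> x hx; apply: le_trans (normIm_le _) _; apply: Bg.
    by rewrite ltr_norml; lra.
  by apply: le_lt_trans hy _; lra.
have Sv x : `|x - cx| <= t -> `|seg (re_v g x) (cy - t) (cy + t)| <= 2 * B * t.
  move=> hx; apply: le_trans (@seg_bound _ B _ _ (cont_re_v x cg) hyt _) _; last lra.
  move=> y hy; apply: le_trans (normRe_le _) _; apply: Bg.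
    by apply: le_lt_trans hx _; lra.
  by rewrite ltr_norml; lra.
have n1 (c : R) : `|c - t - c| <= t by rewrite addrAC subrr add0r normrN gtr0_norm.
have n2 (c : R) : `|c + t - c| <= t by rewrite addrAC subrr add0r gtr0_norm.
have := Sh _ (n1 cy); have := Sh _ (n2 cy); have := Sv _ (n1 cx); have := Sv _ (n2 cx).
rewrite !ler_norml; lra.
Qed.

End Goursat.

(** * A Cauchy estimate by boundary integrals *)

Section CauchyBound.
Context {R : realType}.
Local Notation C := R[i].
Implicit Types f : C -> C.

Definition abs_h f y := fun x : R => modC (f (x +i* y)%C).
Definition abs_v f x := fun y : R => modC (f (x +i* y)%C).

Lemma modC_dist_norm (z w : C) : `|modC z - modC w| <= modC (z - w).
Proof.
rewrite ler_norml modC_dist andbT lerNl opprB.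
by rewrite -[modC (z - w)]modCN opprB; exact: modC_dist.
Qed.

Lemma cont_abs_h f y : ccont f -> continuous (abs_h f y).
Proof.
by move=> cg; apply: cont_comp_ccont => //; [exact: modC_dist_norm|exact: modC_hdist].
Qed.

Lemma cont_abs_v f x : ccont f -> continuous (abs_v f x).
Proof.
by move=> cg; apply: cont_comp_ccont => //; [exact: modC_dist_norm|exact: modC_vdist].
Qed.

Lemma cdiff_cst (u z : C) : cdiff_at (fun=> u) z 0.
Proof.
move=> e e0; exists 1 => // h _; rewrite subrr mul0r subrr modC0.
by rewrite mulr_ge0 ?modC_ge0// ltW.
Qed.

Lemma cdiff_id (z : C) : cdiff_at (fun z => z) z 1.
Proof.
move=> e e0; exists 1 => // h _; rewrite mul1r [z + h]addrC addrK subrr modC0.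
by rewrite mulr_ge0 ?modC_ge0// ltW.
Qed.

Lemma complexV (s t : R) : (s +i* t)%C != 0 ->
  (s +i* t)%C^-1 = ((s / (s ^+ 2 + t ^+ 2)) +i* (- t / (s ^+ 2 + t ^+ 2)))%C.
Proof.
move=> w0; apply: (mulfI w0); rewrite divff//.
have n0 : s ^+ 2 + t ^+ 2 != 0.
  have := exprn_gt0 2 (modC_gt0 w0).
  by rewrite modC_sqr/= lt0r => /andP[].
by apply: complex_ext => /=; field.
Qed.

Section DiffQuotient.
Variables (f : C -> C) (zeta l : C).
Hypothesis df : forall z, exists l, cdiff_at f z l.
Hypothesis dfz : cdiff_at f zeta l.

(** When [l] is the derivative at [zeta], this value makes the quotient continuous there, while it
    stays differentiable elsewhere, as [goursat_punctured] requires. *)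
Definition diffq z := if z == zeta then l else (f z - f zeta) * (z - zeta)^-1.

Lemma diffq_cdiff z : z != zeta -> exists l, cdiff_at diffq z l.
Proof.
move=> zz; have zz' : z - zeta != 0 by rewrite subr_eq0.
have [m Hm] := df z.
have [k Hk] := @cdiffV _ (fun z => z - zeta) z 1 zz' (cdiffD_cst (- zeta) (cdiff_id z)).
have [j Hj] := cdiffM (cdiffD_cst (- f zeta) Hm) Hk.
exists j; apply: cdiff_eq_near Hj; first exact: modC_gt0 zz'.
move=> h hz; rewrite /diffq; case: eqP => // E; move: hz.
by rewrite -E opprD addrA subrr add0r modCN ltxx.
Qed.

Lemma diffq_ccont : ccont diffq.
Proof.
move=> z; have [->|zz] := eqVneq z zeta; last first.
  by have [j] := diffq_cdiff zz; exact: cdiff_cont_at.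
move=> e e0; have e20 : 0 < e / 2 by rewrite divr_gt0.
have [d d0 Hd] := dfz e20.
exists d => // h hd; rewrite {2}/diffq eqxx /diffq.
have [h0|h0] := eqVneq h 0; first by rewrite h0 addr0 eqxx subrr modC0.
rewrite -subr_eq0 [_ + h]addrC addrK (negbTE h0).
have -> : (f (h + zeta) - f zeta) / h - l = (f (zeta + h) - f zeta - l * h) / h.
  by rewrite [RHS]mulrBl mulfK// [h + _]addrC.
rewrite modCM modCV ltr_pdivrMr ?modC_gt0//.
apply: le_lt_trans (Hd _ hd) _; rewrite ltr_pM2r ?modC_gt0//; lra.
Qed.

End DiffQuotient.

Lemma segB_le (h k : R -> R) (c a b : R) : continuous h -> continuous k -> a <= b ->
  (forall x, a <= x <= b -> h x <= k x - c) -> seg h a b <= seg k a b - c * (b - a).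
Proof.
move=> ch ck ab H; have cc : continuous (fun _ : R => c) by move=> x; exact: cvg_cst.
rewrite -(seg_cst c ab) -segB//; apply: seg_le => //.
by move=> x; apply: cvgB; [exact: ck|exact: cc].
Qed.

Lemma segB_ge (h k : R -> R) (c a b : R) : continuous h -> continuous k -> a <= b ->
  (forall x, a <= x <= b -> c - k x <= h x) -> c * (b - a) - seg k a b <= seg h a b.
Proof.
move=> ch ck ab H; have cc : continuous (fun _ : R => c) by move=> x; exact: cvg_cst.
rewrite -(seg_cst c ab) -segB//; apply: seg_le => //.
by move=> x; apply: cvgB; [exact: cc|exact: ck].
Qed.

(** The denominator is at most [4 + 4]. The fraction is the real part of [1 / (s + i t)] or, with
    the roles of [s] and [t] exchanged, minus its imaginary part, on a side at distance between 1
    and 2 from the centre. *)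
Lemma frac_ge_inv8 (s t : R) : -2 <= s <= 2 -> -2 <= t <= 2 -> 1 <= s ->
  1 / 8 <= s / (s ^+ 2 + t ^+ 2).
Proof.
move=> hs ht s1; have s20 : 0 < s ^+ 2 + t ^+ 2.
  rewrite ltr_pwDl ?sqr_ge0//; apply: exprn_gt0; lra.
rewrite ler_pdivlMr//.
have : s ^+ 2 <= 4 by rewrite expr2; nra.
have : t ^+ 2 <= 4 by rewrite expr2; nra.
lra.
Qed.

Lemma frac_le_inv8 (s t : R) : -2 <= s <= 2 -> -2 <= t <= 2 -> s <= -1 ->
  s / (s ^+ 2 + t ^+ 2) <= - (1 / 8).
Proof.
move=> hs ht s1; have : 1 / 8 <= - s / ((- s) ^+ 2 + t ^+ 2) by apply: frac_ge_inv8; lra.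
by rewrite sqrrN mulNr; lra.
Qed.

(* Since [f zeta = rho] is real and [1 / (z - zeta)] has, along each outward side, the
   relevant component at least [1/8], each side contributes at most the integral of
   [|f| - rho / 8] to the integral of the difference quotient, which is 0. *)
Lemma cauchy_bound_real f cx cy x1 x2 y1 y2 (rho : R) :
  (forall z, exists l, cdiff_at f z l) -> f (cx +i* cy)%C = rho%:C%C -> 0 <= rho ->
  cx - 2 <= x1 <= cx - 1 -> cx + 1 <= x2 <= cx + 2 ->
  cy - 2 <= y1 <= cy - 1 -> cy + 1 <= y2 <= cy + 2 ->
  rho <= seg (abs_h f y1) x1 x2 + seg (abs_v f x2) y1 y2
         + seg (abs_h f y2) x1 x2 + seg (abs_v f x1) y1 y2.
Proof.
move=> df fz rho0 hx1 hx2 hy1 hy2; set zeta := (cx +i* cy)%C in fz.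
have [l dfz] := df zeta.
have cf := cdiff_cont df.
pose g := diffq f zeta l.
have cg : ccont g by exact: diffq_ccont.
have I0 : im_circ g x1 x2 y1 y2 = 0.
  apply: (@goursat_punctured _ _ cx cy) => //; [lra|lra|].
  by move=> z; exact: diffq_cdiff.
(* Off [zeta], [g] is [f / (z - zeta)] minus [rho / (z - zeta)]; since [modC (z - zeta) >= 1] on the
   boundary, the first term has modulus at most that of [f]. *)
have gE x y : -2 <= x - cx <= 2 -> -2 <= y - cy <= 2 ->
   1 <= `|x - cx| \/ 1 <= `|y - cy| ->
   `|complex.Re (g (x +i* y)%C) + rho * ((x - cx) / ((x - cx) ^+ 2 + (y - cy) ^+ 2))|
      <= modC (f (x +i* y)%C) /\
   `|complex.Im (g (x +i* y)%C) - rho * ((y - cy) / ((y - cy) ^+ 2 + (x - cx) ^+ 2))|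
      <= modC (f (x +i* y)%C).
  move=> hs ht st.
  set s := x - cx in hs st *; set t := y - cy in ht st *.
  have w1 : 1 <= modC (s +i* t)%C.
    by case: st => /le_trans; apply; [exact: (normRe_le (s +i* t)%C)|exact: (normIm_le (s +i* t)%C)].
  have w0 : (s +i* t)%C != 0 by apply/eqP => E; move: w1; rewrite E modC0 ler10.
  pose k := f (x +i* y)%C * (s +i* t)%C^-1.
  have hk : modC k <= modC (f (x +i* y)%C).
    rewrite modCM -[leRHS]mulr1 ler_wpM2l ?modC_ge0// modCV invf_le1 ?modC_gt0//.
  have gk : g (x +i* y)%C = k - ((rho * (s / (s ^+ 2 + t ^+ 2)))
      +i* (- (rho * (t / (s ^+ 2 + t ^+ 2)))))%C.
    rewrite /g /diffq -subr_eq0.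
    have -> : (x +i* y)%C - zeta = (s +i* t)%C by [].
    rewrite (negbTE w0) mulrBl fz; congr (_ - _); rewrite complexV//.
    by apply: complex_ext => /=; ring.
  rewrite [t ^+ 2 + s ^+ 2]addrC; split; apply: le_trans hk.
    by apply: le_trans (normRe_le _); rewrite gk ReD ReN/= subrK.
  by apply: le_trans (normIm_le _); rewrite gk ImD ImN/= opprK addrK.
have r8 u : 1 / 8 <= u -> rho / 8 <= rho * u.
  by move=> hu; have := ler_wpM2l rho0 hu; lra.
have r8N u : u <= - (1 / 8) -> rho * u <= - (rho / 8).
  by move=> hu; have := ler_wpM2l rho0 hu; lra.
have A1 : seg (im_h g y1) x1 x2 <= seg (abs_h f y1) x1 x2 - rho / 8 * (x2 - x1).
  apply: segB_le; [exact: cont_im_h|exact: cont_abs_h|lra|].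
  move=> x hx; have h1 : -2 <= x - cx <= 2 by lra.
  have h2 : -2 <= y1 - cy <= 2 by lra.
  have h3 : y1 - cy <= -1 by lra.
  have [|_] := gE x y1 h1 h2; first by right; rewrite ler_normr; lra.
  have := r8N _ (frac_le_inv8 h2 h1 h3).
  by rewrite /im_h /abs_h ler_norml; lra.
have A2 : rho / 8 * (x2 - x1) - seg (abs_h f y2) x1 x2 <= seg (im_h g y2) x1 x2.
  apply: segB_ge; [exact: cont_im_h|exact: cont_abs_h|lra|].
  move=> x hx; have h1 : -2 <= x - cx <= 2 by lra.
  have h2 : -2 <= y2 - cy <= 2 by lra.
  have h3 : 1 <= y2 - cy by lra.
  have [|_] := gE x y2 h1 h2; first by right; rewrite ler_normr; lra.
  have := r8 _ (frac_ge_inv8 h2 h1 h3).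
  by rewrite /im_h /abs_h ler_norml; lra.
have A3 : seg (re_v g x2) y1 y2 <= seg (abs_v f x2) y1 y2 - rho / 8 * (y2 - y1).
  apply: segB_le; [exact: cont_re_v|exact: cont_abs_v|lra|].
  move=> y hy; have h1 : -2 <= x2 - cx <= 2 by lra.
  have h2 : -2 <= y - cy <= 2 by lra.
  have h3 : 1 <= x2 - cx by lra.
  have [|+ _] := gE x2 y h1 h2; first by left; rewrite ler_normr; lra.
  have := r8 _ (frac_ge_inv8 h1 h2 h3).
  by rewrite /re_v /abs_v ler_norml; lra.
have A4 : rho / 8 * (y2 - y1) - seg (abs_v f x1) y1 y2 <= seg (re_v g x1) y1 y2.
  apply: segB_ge; [exact: cont_re_v|exact: cont_abs_v|lra|].
  move=> y hy; have h1 : -2 <= x1 - cx <= 2 by lra.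
  have h2 : -2 <= y - cy <= 2 by lra.
  have h3 : x1 - cx <= -1 by lra.
  have [|+ _] := gE x1 y h1 h2; first by left; rewrite ler_normr; lra.
  have := r8N _ (frac_le_inv8 h1 h2 h3).
  by rewrite /re_v /abs_v ler_norml; lra.
(* Every side has length at least 2, so the four terms in [rho / 8] add up to at least [rho]. *)
have B1 : rho * 2 <= rho * (x2 - x1) by rewrite ler_wpM2l//; lra.
have B2 : rho * 2 <= rho * (y2 - y1) by rewrite ler_wpM2l//; lra.
by move: I0; rewrite /im_circ; lra.
Qed.

Lemma unimodular_rot (z : C) : exists u : C, modC u = 1 /\ u * z = (modC z)%:C%C.
Proof.
have [->|z0] := eqVneq z 0.
  by exists 1; rewrite mulr0 modC0; split=> //; exact: ComplexField.Normc.normc1.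
exists ((modC z)%:C%C / z); rewrite divfK//; split=> //.
by rewrite modCM modCV modC_real ger0_norm ?modC_ge0// divff// gt_eqF// modC_gt0.
Qed.

(** Multiplying [f] by a number of modulus 1 makes the central value real and nonnegative and leaves
    every modulus unchanged. *)
Lemma cauchy_bound f cx cy x1 x2 y1 y2 :
  (forall z, exists l, cdiff_at f z l) ->
  cx - 2 <= x1 <= cx - 1 -> cx + 1 <= x2 <= cx + 2 ->
  cy - 2 <= y1 <= cy - 1 -> cy + 1 <= y2 <= cy + 2 ->
  modC (f (cx +i* cy)%C) <= seg (abs_h f y1) x1 x2 + seg (abs_v f x2) y1 y2
         + seg (abs_h f y2) x1 x2 + seg (abs_v f x1) y1 y2.
Proof.
move=> df hx1 hx2 hy1 hy2; have [u [u1 uE]] := unimodular_rot (f (cx +i* cy)%C).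
have duf z : exists l, cdiff_at (fun z => u * f z) z l.
  by have [l Hl] := df z; exact: cdiffM (cdiff_cst u z) Hl.
have := cauchy_bound_real duf uE (modC_ge0 _) hx1 hx2 hy1 hy2.
have Eh y : abs_h (fun z => u * f z) y = abs_h f y.
  by apply/funext => x; rewrite /abs_h modCM u1 mul1r.
have Ev x : abs_v (fun z => u * f z) x = abs_v f x.
  by apply/funext => y; rewrite /abs_v modCM u1 mul1r.
by rewrite !Eh !Ev.
Qed.

End CauchyBound.

(** * Joint measurability of functions of two real variables *)

Section Measurability.
Context {R : realType}.

(* [F] is the pointwise limit of [F (floor (n x) / n) y]. *)
Lemma measurable_caratheodory (F : R -> R -> R) :
  (forall y, continuous (F ^~ y)) -> (forall x, measurable_fun setT (F x)) ->
  measurable_fun setT (fun xy : R * R => F xy.1 xy.2).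
Proof.
move=> cF mF.
pose r (n : nat) (x : R) : R := (Num.floor (x * n.+1%:R))%:~R / n.+1%:R.
apply: (@measurable_fun_cvg _ _ _ _ (fun n xy => F (r n xy.1) xy.2)).
  move=> n _ B mB; rewrite setTI.
  (* On each strip where the floor equals [k] the function depends on [y] only, so the preimage is a
     countable union of measurable rectangles. *)
  have -> : (fun xy : R * R => F (r n xy.1) xy.2) @^-1` B =
     \bigcup_(k : int) (`[k%:~R / n.+1%:R, (k + 1)%:~R / n.+1%:R[%classic
       `*` (F (k%:~R / n.+1%:R) @^-1` B)).
    apply/seteqP; split=> [[x y] /= Bxy|[x y] [k _ [/=]]].
      exists (Num.floor (x * n.+1%:R)) => //; split=> //=.
      rewrite in_itv/= ler_pdivrMr ?ltr_pdivlMr ?ltr0n//.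
      exact: floor_itv.
    rewrite in_itv/= ler_pdivrMr ?ltr_pdivlMr ?ltr0n// => /floor_def kE.
    by rewrite /r kE.
  apply: countable_bigcupT_measurable => // k; apply: measurableX => //.
  by rewrite -[X in measurable X]setTI; exact: mF.
move=> [x y] _ /=.
suff H : r ^~ x @ \oo --> x by exact: (cvg_comp _ _ H (cF y x)).
apply/cvgrPdist_lt => e e0; near=> n.
have n0 : 0 < n.+1%:R :> R by rewrite ltr0n.
have := floor_itv (x * n.+1%:R); rewrite -ler_pdivrMr// -ltr_pdivlMr// -/(r n x) => /andP[h1 h2].
have h3 : n.+1%:R^-1 < e by near: n; exact: near_infty_natSinv_lt (PosNum e0).
rewrite ger0_norm ?subr_ge0//; apply: le_lt_trans h3.
by move: h2; rewrite intrD (_ : 1%:~R = 1 :> R)// mulrDl mul1r -/(r n x) lerBlDl => /ltW.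
Unshelve. all: by end_near. Qed.

End Measurability.

(** * Growth of functions in the Fock space *)

Section FockDensity.
Context {R : realType}.
Local Notation C := R[i].
Local Notation mu := (@lebesgue_measure R).
Implicit Types f : C -> C.

(** Written exactly as the integrand of [fock_norm], so that [fock_normE] holds by conversion. *)
Definition fdens (nu : R) f (xy : R * R) : R :=
  (modC (f (xy.1 +i* xy.2)%C)) `^ nu * expR (- nu * modC (xy.1 +i* xy.2)%C ^+ 2 / 2).

Definition fint nu f : \bar R := (\int[areaC]_xy (fdens nu f xy)%:E)%E.

Lemma fock_normE nu f : fock_norm nu f = (((nu / (2 * pi))%:E * fint nu f) `^ nu^-1)%E.
Proof. by []. Qed.

Lemma fdens_ge0 nu f xy : 0 <= fdens nu f xy.
Proof. by rewrite mulr_ge0 ?powR_ge0 ?expR_ge0. Qed.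

Lemma ccont_id : ccont (@id C).
Proof. by move=> z e e0; exists e => // h; rewrite addrAC subrr add0r. Qed.

Lemma measurable_modC_comp f : ccont f ->
  measurable_fun setT (fun xy : R * R => modC (f (xy.1 +i* xy.2)%C)).
Proof.
move=> cf; apply: (@measurable_caratheodory R (fun x y => modC (f (x +i* y)%C))).
  by move=> y; exact: cont_abs_h.
by move=> x; apply: continuous_measurable_fun; exact: cont_abs_v.
Qed.

Lemma measurable_fdens nu f : ccont f -> measurable_fun setT (fdens nu f).
Proof.
move=> cf; apply: measurable_funM.
  apply: (measurableT_comp (measurable_powR nu)); exact: measurable_modC_comp.
apply: measurableT_comp => //.
apply: measurable_funM => //; apply: measurable_funM => //.
by apply: measurable_funX; exact: (measurable_modC_comp ccont_id).
Qed.

Lemma integral_itv_cst (k a b : R) : a <= b ->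
  (\int[mu]_(_ in `[a, b]) k%:E = (k * (b - a))%:E)%E.
Proof.
move=> ab; rewrite integral_cst//; have E : lebesgue_measure `[a, b] = (b - a)%:E :> \bar R.
  rewrite lebesgue_measure_itv/= lte_fin EFinB.
  by move: ab; rewrite le_eqVlt => /predU1P[->|->]//; rewrite ltxx subee.
by rewrite EFinM; congr (_ * _)%E; exact: E.
Qed.

(** Otherwise the inner integral exceeds [N + 1] at every [x] of an interval of length 1, and
    Tonelli's theorem makes the total integral at least [N + 1], which is more than [N]. *)
Lemma good_line_x (g : R * R -> R) (N a : R) : measurable_fun setT g ->
  (forall xy, 0 <= g xy) -> (\int[areaC]_xy (g xy)%:E <= N%:E)%E ->
  exists2 x, a <= x <= a + 1 & (\int[mu]_y (g (x, y))%:E <= (N + 1)%:E)%E.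
Proof.
move=> mg g0 gN; apply: contrapT => H.
have mG : measurable_fun setT (EFin \o g) by exact/measurable_EFinP.
have G0 xy : (0 <= (EFin \o g) xy)%E by rewrite lee_fin.
have F0 x : (0 <= fubini_F mu (EFin \o g) x)%E by apply: integral_ge0.
have big x : a <= x <= a + 1 -> ((N + 1)%:E <= fubini_F mu (EFin \o g) x)%E.
  move=> hx; rewrite leNgt; apply/negP => h; apply: H; exists x => //.
  by apply: ltW.
have := fubini_tonelli1 (m1 := mu) (m2 := mu) _ mG G0.
have mF := measurable_fun_fubini_tonelli_F (m2 := mu) _ mG G0.
rewrite /areaC in gN; move=> E; move: (gN); rewrite leNgt => /negP; apply.
rewrite [ltRHS]E.
apply: (@lt_le_trans _ _ (N + 1)%:E); first by rewrite lte_fin ltrDl.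
pose b := a + 1.
apply: (@le_trans _ _ (\int[mu]_(x in `[a, b]) fubini_F mu (EFin \o g) x)%E).
  have <- : (\int[mu]_(x in `[a, b]) (N + 1)%:E = (N + 1)%:E)%E.
    by rewrite integral_itv_cst ?lerDl// /b addrAC subrr add0r mulr1.
  have N0 : 0 <= N + 1.
    have : (0%:E <= N%:E)%E by apply: le_trans gN; apply: integral_ge0 => xy _; rewrite lee_fin.
    by rewrite lee_fin => N0; rewrite addr_ge0.
  apply: ge0_le_integral => //; first exact: measurable_funTS.
by apply: ge0_subset_integral => //.
Qed.

Lemma good_line_y (g : R * R -> R) (N a : R) : measurable_fun setT g ->
  (forall xy, 0 <= g xy) -> (\int[areaC]_xy (g xy)%:E <= N%:E)%E ->
  exists2 y, a <= y <= a + 1 & (\int[mu]_x (g (x, y))%:E <= (N + 1)%:E)%E.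
Proof.
move=> mg g0 gN.
pose g' (xy : R * R) := g (xy.2, xy.1).
have mg' : measurable_fun setT g'.
  by apply: measurableT_comp => //; exact: measurable_swap.
have [||y] := @good_line_x g' N a mg'; [by move=> xy; exact: g0| |by exists y].
apply: le_trans gN.
have mG : measurable_fun setT (EFin \o g) by exact/measurable_EFinP.
have mG' : measurable_fun setT (EFin \o g') by exact/measurable_EFinP.
have -> : (\int[areaC]_xy (g' xy)%:E = \int[mu]_x fubini_F mu (EFin \o g') x)%E.
  by apply: (fubini_tonelli1 (m1 := mu) (m2 := mu) _ mG') => xy; rewrite lee_fin; exact: g0.
have -> // : (\int[areaC]_xy (g xy)%:E = \int[mu]_y fubini_G mu (EFin \o g) y)%E.
by apply: (fubini_tonelli2 (m1 := mu) (m2 := mu) _ mG) => xy; rewrite lee_fin; exact: g0.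
Qed.

(** A substitute for Hölder's inequality in passing from an integral of the power [nu] to one of the
    first power. *)
Lemma le_1DpowR (A nu : R) : 0 <= A -> 1 <= nu -> A <= 1 + A `^ nu.
Proof.
move=> A0 nu1; have [A1|A1] := leP A 1.
  by apply: le_trans A1 _; rewrite lerDl powR_ge0.
apply: (@le_trans _ _ (A `^ nu)); last by rewrite lerDr.
by rewrite -{1}(powRr1 A0) ler_powR// ltW.
Qed.

(* With [A = |f z| exp (- |z|^2 / 2)], the density is [A^nu], and [A <= 1 + A^nu]. *)
Lemma modC_le_fdens nu f x y M : 1 <= nu -> expR (modC (x +i* y)%C ^+ 2 / 2) <= M ->
  modC (f (x +i* y)%C) <= M * (1 + fdens nu f (x, y)).
Proof.
move=> nu1 HM; set m := modC (x +i* y)%C ^+ 2 / 2 in HM *.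
set a := modC (f _); pose A := a * expR (- m).
have a0 : 0 <= a by exact: modC_ge0.
have A0 : 0 <= A by rewrite mulr_ge0 ?expR_ge0.
have -> : a = expR m * A by rewrite /A mulrCA -expRD subrr expR0 mulr1.
apply: ler_pM; rewrite ?expR_ge0//.
apply: le_trans (le_1DpowR A0 nu1) _; rewrite lerD2l /fdens/= -/a.
rewrite /A powRM ?expR_ge0// -expRM.
by rewrite (_ : - m * nu = - nu * modC (x +i* y)%C ^+ 2 / 2)// /m; ring.
Qed.

(** The segment has length at most 4, which bounds the contribution of the constant 1, and that of
    [g] is at most its integral over the whole line. *)
Lemma seg_le_line (h g : R -> R) (M N a b : R) : continuous h -> measurable_fun setT g ->
  (forall t, 0 <= h t) -> (forall t, 0 <= g t) -> 0 <= M -> a <= b -> b - a <= 4 ->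
  (\int[mu]_t (g t)%:E <= N%:E)%E ->
  (forall t, a <= t <= b -> h t <= M * (1 + g t)) -> seg h a b <= M * (4 + N).
Proof.
move=> ch mg h0 g0 M0 ab ab4 gN H.
have fin : (\int[mu]_(t in `[a, b]) (h t)%:E)%E \is a fin_num.
  by apply: integrable_fin_num => //; exact: seg_integrable.
rewrite /seg /Rintegral -lee_fin fineK//.
have mh : measurable_fun setT h by exact: continuous_measurable_fun.
apply: (@le_trans _ _ (\int[mu]_(t in `[a, b]) (M%:E * (1%:E + (g t)%:E)))%E).
  apply: ge0_le_integral => //.
  - by move=> t _; rewrite lee_fin.
  - by apply/measurable_EFinP; exact: measurable_funTS.
  - apply: measurable_funTS; apply: (@measurableT_comp _ _ _ _ _ _ EFin _ (fun t => M * (1 + g t))) => //.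
    by apply: measurable_funM => //; exact: measurable_funD.
have mgE : measurable_fun `[a, b] (EFin \o g).
  by apply/measurable_EFinP; exact: measurable_funTS.
rewrite ge0_integralZl_EFin//; last 2 first.
  by move=> t _; rewrite -EFinD lee_fin addr_ge0.
  by apply: emeasurable_funD.
rewrite EFinM; apply: lee_wpmul2l; first by rewrite lee_fin.
rewrite ge0_integralD//; [|by move=> t _; rewrite lee_fin].
rewrite EFinD; apply: leeD.
  by rewrite integral_itv_cst// mul1r lee_fin.
apply: le_trans gN; apply: ge0_subset_integral => //; first exact/measurable_EFinP.
by move=> t _; rewrite lee_fin.
Qed.

Lemma box_arith (c u v : R) : c - 2 <= u <= c - 2 + 1 -> c + 1 <= v <= c + 1 + 1 ->
  [/\ u <= v, v - u <= 4, c - 2 <= u <= c - 1, c + 1 <= v <= c + 2 &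
      forall t, u <= t <= v -> c - 2 <= t <= c + 2].
Proof. by move=> hu hv; split=> [||||t ht]; lra. Qed.

(** Each of the four sides contributes at most [M * (5 + N)]. The 4 in the exponent is the bound
    [2 + 2] for the distance from [z] to a point of the box. *)
Lemma pointwise_bound nu f (N : R) z : 1 <= nu -> entire f -> (fint nu f <= N%:E)%E ->
  modC (f z) <= 4 * (5 + N) * expR ((modC z + 4) ^+ 2 / 2).
Proof.
move=> nu1 /entire_cdiff df fN; have cf := cdiff_cont df.
have mg := measurable_fdens nu cf; have g0 := fdens_ge0 nu f.
case: z => cx cy; set M := expR _; have M0 : 0 <= M by exact: expR_ge0.
have hM x y : cx - 2 <= x <= cx + 2 -> cy - 2 <= y <= cy + 2 ->
    modC (f (x +i* y)%C) <= M * (1 + fdens nu f (x, y)).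
  move=> hx hy; apply: modC_le_fdens => //; rewrite ler_expR ler_pM2r ?invr_gt0//.
  rewrite ler_sqr ?nnegrE ?addr_ge0 ?modC_ge0//.
  have -> : (x +i* y)%C = (cx +i* cy)%C + ((x - cx) +i* (y - cy))%C.
    by apply: complex_ext => /=; ring.
  apply: le_trans (modCD _ _) _; rewrite lerD2l.
  apply: le_trans (modC_le_add _ _) _.
  have -> : 4 = 2 + 2 :> R by ring.
  by apply: lerD; rewrite ler_norml; clear -hx hy; lra.
clearbody M.
have [x1 hx1 Hx1] := good_line_x (cx - 2) mg g0 fN.
have [x2 hx2 Hx2] := good_line_x (cx + 1) mg g0 fN.
have [y1 hy1 Hy1] := good_line_y (cy - 2) mg g0 fN.
have [y2 hy2 Hy2] := good_line_y (cy + 1) mg g0 fN.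
have [X1 X2 X3 X4 X5] := box_arith hx1 hx2.
have [Y1 Y2 Y3 Y4 Y5] := box_arith hy1 hy2.
have xx1 : x1 <= x1 <= x2 by rewrite lexx.
have xx2 : x1 <= x2 <= x2 by rewrite lexx andbT.
have yy1 : y1 <= y1 <= y2 by rewrite lexx.
have yy2 : y1 <= y2 <= y2 by rewrite lexx andbT.
have Sh y : cy - 2 <= y <= cy + 2 -> (\int[mu]_x (fdens nu f (x, y))%:E <= (N + 1)%:E)%E ->
    seg (abs_h f y) x1 x2 <= M * (4 + (N + 1)).
  move=> hy Hy; apply: (@seg_le_line _ (fun x => fdens nu f (x, y))) => //.
  - exact: cont_abs_h.
  - exact: measurable_fun_pair1.
  - by move=> x; exact: modC_ge0.
  - by move=> x hx; apply: hM => //; exact: X5.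
have Sv x : cx - 2 <= x <= cx + 2 -> (\int[mu]_y (fdens nu f (x, y))%:E <= (N + 1)%:E)%E ->
    seg (abs_v f x) y1 y2 <= M * (4 + (N + 1)).
  move=> hx Hx; apply: (@seg_le_line _ (fun y => fdens nu f (x, y))) => //.
  - exact: cont_abs_v.
  - exact: measurable_fun_pair2.
  - by move=> y; exact: modC_ge0.
  - by move=> y hy; apply: hM => //; exact: Y5.
apply: le_trans (cauchy_bound df X3 X4 Y3 Y4) _.
have -> : 4 * (5 + N) * M = M * (4 + (N + 1)) + M * (4 + (N + 1))
    + M * (4 + (N + 1)) + M * (4 + (N + 1)) by ring.
apply: lerD; first apply: lerD; first apply: lerD.
- exact: Sh (Y5 _ yy1) Hy1.
- exact: Sv (X5 _ xx2) Hx2.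
- exact: Sh (Y5 _ yy2) Hy2.
- exact: Sv (X5 _ xx1) Hx1.
Qed.

(** * Gaussian integrals and domination by them *)

Lemma gauss_line (c : R) : 0 < c ->
  exists K : R, 0 <= K /\ (\int[mu]_x (expR (- c * x ^+ 2))%:E = K%:E)%E.
Proof.
(* With variance [1 / (2 * c)] the centred normal density is [expR (- c * x ^+ 2)] up to its peak
   value, and its integral is 1. *)
move=> c0; pose s := Num.sqrt ((2 * c)^-1).
have c20 : 0 < (2 * c)^-1 by rewrite invr_gt0 mulr_gt0.
have s0 : 0 < s by rewrite sqrtr_gt0.
have s2 : s ^+ 2 = (2 * c)^-1 by rewrite sqr_sqrtr// ltW.
have p0 : 0 < normal_peak s by apply: normal_peak_gt0; rewrite gt_eqF.
exists (normal_peak s)^-1; split; first by rewrite invr_ge0 ltW.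
have := integral_normal_pdf 0 s; rewrite normal_pdfE ?gt_eqF//.
have E : (fun x => (normal_peak s * normal_fun 0 s x)%:E) =
         (fun x => (normal_peak s)%:E * (expR (- c * x ^+ 2))%:E)%E.
  apply/funext => x; rewrite -EFinM /normal_fun subr0 s2; congr (_ * expR _)%:E.
  by field; rewrite gt_eqF.
rewrite E ge0_integralZl_EFin//; last 2 first.
  apply/measurable_EFinP; apply: measurableT_comp => //.
  by apply: measurable_funM => //; exact: measurable_funX.
  exact: ltW.
set I := (\int[_]_(_ in _) _)%E; have : (0 <= I)%E.
  by apply: integral_ge0 => x _; rewrite lee_fin expR_ge0.
case: I => [r _|_|//].
  rewrite -EFinM => -[pr]; congr (_%:E); by apply: (mulfI (lt0r_neq0 p0)); rewrite pr divff ?lt0r_neq0.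
by rewrite gt0_muley ?lte_fin.
Qed.

Lemma gauss_plane (c : R) : 0 < c -> exists K : R, 0 <= K /\
  (\int[areaC]_xy (expR (- c * modC (xy.1 +i* xy.2)%C ^+ 2))%:E = K%:E)%E.
Proof.
move=> c0; have [K [K0 HK]] := gauss_line c0; exists (K * K); split; first exact: mulr_ge0.
have me (a : R) : measurable_fun setT (fun x : R => expR (a * x ^+ 2)).
  by apply: measurableT_comp => //; apply: measurable_funM => //; exact: measurable_funX.
have mG : measurable_fun setT (fun xy : R * R => (expR (- c * modC (xy.1 +i* xy.2)%C ^+ 2))%:E).
  apply/measurable_EFinP; apply: (measurableT_comp (me (- c))).
  exact: (measurable_modC_comp ccont_id).
have -> := fubini_tonelli1 (m1 := mu) (m2 := mu) _ mG.
  transitivity (\int[mu]_x ((expR (- c * x ^+ 2))%:E * K%:E))%E.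
    apply: eq_integral => x _; rewrite /fubini_F -HK.
    rewrite -ge0_integralZl_EFin//.
    - by apply: eq_integral => y _; rewrite -EFinM -expRD modC_sqr/= mulrDr.
    - by apply/measurable_EFinP; exact: me.
  rewrite ge0_integralZr//.
  - by rewrite HK.
  - by apply/measurable_EFinP; exact: me.
by move=> xy; rewrite lee_fin expR_ge0.
Qed.

(** The weight of the Fock space cancels the term [modC z ^+ 2 / 2] of the exponent, which leaves a
    Gaussian of rate [nu * c]. *)
Lemma fint_le_gauss nu f (B c K : R) : 0 <= nu -> 0 <= B -> ccont f ->
  (forall z, modC (f z) <= B * expR (modC z ^+ 2 / 2 - c * modC z ^+ 2)) ->
  (\int[areaC]_xy (expR (- (nu * c) * modC (xy.1 +i* xy.2)%C ^+ 2))%:E = K%:E)%E ->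
  (fint nu f <= (B `^ nu * K)%:E)%E.
Proof.
move=> nu0 B0 cf Hf HK; rewrite EFinM -HK /fint.
have mG : measurable_fun setT (fun xy : R * R => (expR (- (nu * c) * modC (xy.1 +i* xy.2)%C ^+ 2))%:E).
  apply/measurable_EFinP; apply: measurableT_comp => //; apply: measurable_funM => //.
  by apply: measurable_funX; exact: (measurable_modC_comp ccont_id).
rewrite -ge0_integralZl_EFin//; last exact: powR_ge0.
apply: ge0_le_integral => //.
- by move=> xy _; rewrite lee_fin fdens_ge0.
- by apply/measurable_EFinP; exact: measurable_fdens.
- exact: emeasurable_funM.
move=> [x y] _; rewrite -EFinM lee_fin /fdens; cbn [fst snd].
set m := modC (x +i* y)%C; apply: (@le_trans _ _ ((B * expR (m ^+ 2 / 2 - c * m ^+ 2)) `^ nu * expR (- nu * m ^+ 2 / 2))).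
  rewrite ler_wpM2r ?expR_ge0// ge0_ler_powR ?nnegrE ?modC_ge0//.
  by rewrite mulr_ge0 ?expR_ge0.
rewrite powRM ?expR_ge0// -mulrA ler_wpM2l ?powR_ge0// -expRM -expRD ler_expR.
by rewrite le_eqVlt; apply/orP; left; apply/eqP; field.
Qed.

End FockDensity.

(** * Passage between the norm and the integral of the density *)

Section FockNorm.
Context {R : realType}.
Local Notation C := R[i].
Implicit Types (f : C -> C) (nu : R).

Lemma fint_ge0 nu f : (0 <= fint nu f)%E.
Proof. by apply: integral_ge0 => xy _; rewrite lee_fin fdens_ge0. Qed.

Lemma fock_cst_gt0 nu : 0 < nu -> 0 < nu / (2 * pi) :> R.
Proof. by move=> nu0; rewrite divr_gt0// mulr_gt0// pi_gt0. Qed.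

Lemma fock_norm_le nu f (N : R) : 0 < nu -> (fint nu f <= N%:E)%E ->
  (fock_norm nu f <= ((nu / (2 * pi) * N) `^ nu^-1)%:E)%E.
Proof.
move=> nu0 H; rewrite fock_normE -poweR_EFin EFinM.
have k0 := fock_cst_gt0 nu0.
have k0' : (0 <= (nu / (2 * pi))%:E)%E by rewrite lee_fin ltW.
have le1 : ((nu / (2 * pi))%:E * fint nu f <= (nu / (2 * pi))%:E * N%:E)%E by exact: lee_wpmul2l.
have ge1 : (0 <= (nu / (2 * pi))%:E * fint nu f)%E by exact/mule_ge0/fint_ge0.
apply: gt0_ler_poweR => //; first by rewrite invr_ge0 ltW.
  by rewrite in_itv/= ge1 leey.
by rewrite in_itv/= (le_trans ge1 le1) leey.
Qed.

Lemma fint_fin nu f : 0 < nu -> (fock_norm nu f < +oo)%E ->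
  exists2 N : R, 0 <= N & fint nu f = N%:E.
Proof.
move=> nu0; rewrite fock_normE => H.
have {}H : ((nu / (2 * pi))%:E * fint nu f < +oo)%E.
  by apply: lty_poweRy H; rewrite invr_eq0 gt_eqF.
have := fint_ge0 nu f; case: (fint nu f) H => [N _|+ _|//].
  by rewrite lee_fin => N0; exists N.
by rewrite gt0_muley// lte_fin fock_cst_gt0.
Qed.

Lemma fint_le_of_norm nu f (M : R) : 0 < nu -> 0 <= M -> (fock_norm nu f <= M%:E)%E ->
  (fint nu f <= (M `^ nu / (nu / (2 * pi)))%:E)%E.
Proof.
move=> nu0 M0 H; have [|N N0 NE] := fint_fin nu0 (_ : (fock_norm nu f < +oo)%E).
  by apply: le_lt_trans H _; exact: ltry.
have k0 := fock_cst_gt0 nu0.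
move: H; rewrite fock_normE NE -EFinM poweR_EFin !lee_fin => H.
rewrite ler_pdivlMr// mulrC.
have kN : 0 <= nu / (2 * pi) * N by rewrite mulr_ge0// ltW.
rewrite -[leLHS]powRr1// -[X in _ `^ X](mulVf (_ : nu != 0)) ?gt_eqF// powRrM.
by apply: ge0_ler_powR; rewrite ?nnegrE ?powR_ge0// ltW.
Qed.

End FockNorm.

(** * Iterates of the weighted composition operator *)

Section WeightedComposition.
Context {R : realType}.
Local Notation C := R[i].
Variables (a b p q : C).
Hypothesis a_lt1 : 0 < modC a < 1.

Let T := Wcomp (fun z => cexp (p + q * z)) (fun z => a * z + b).
Let z0 := b / (1 - a).
Let s := complex.Re p + complex.Re (q * b / (1 - a)).
Let K := modC q * 2 / modC (1 - a).

Let a1 : 1 - a != 0.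
Proof.
rewrite subr_eq0; apply/eqP => E; move: a_lt1; rewrite -E.
by rewrite /modC ComplexField.Normc.normc1 ltxx andbF.
Qed.

Let K_ge0 : 0 <= K.
Proof. by rewrite !mulr_ge0 ?invr_ge0 ?modC_ge0. Qed.

(** In the coordinate [z - z0] the affine map is multiplication by [a], and [p + q * z] is
    [(p + q * z0) + q * (z - z0)]; the exponents then add up to a geometric sum. *)
Lemma iter_Wcomp n f z : iter n T f z =
  cexp (n%:R * (p + q * z0) + q * ((1 - a ^+ n) / (1 - a)) * (z - z0))
  * f (z0 + a ^+ n * (z - z0)).
Proof.
elim: n z => [|n IH] z.
  by rewrite /= !mul0r expr0 subrr mul0r mulr0 mul0r addr0 cexp0 !mul1r addrC subrK.
rewrite iterS {1}/T /Wcomp IH mulrA -cexpD; congr (cexp _ * f _).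
  by rewrite -natr1 exprS /z0; field.
by rewrite exprS /z0; field.
Qed.

Lemma Re_natM n (w : C) : complex.Re (n%:R * w) = n%:R * complex.Re w.
Proof.
by rewrite !mulr_natl; elim: n => [|n IH]; rewrite ?mulr0n// !mulrS ReD IH.
Qed.

(** The constant [K] serves every [n], because [1 - a ^+ n] has modulus at most 2. *)
Lemma modC_iter n f z : exists2 k : R, `|k| <= K * modC (z - z0) &
  modC (iter n T f z) = expR (n%:R * s + k) * modC (f (z0 + a ^+ n * (z - z0))).
Proof.
exists (complex.Re (q * ((1 - a ^+ n) / (1 - a)) * (z - z0))).
  apply: le_trans (normRe_le _) _; rewrite !modCM modCV ler_wpM2r ?modC_ge0//.
  rewrite /K -mulrA ler_wpM2l ?modC_ge0// ler_wpM2r ?invr_ge0 ?modC_ge0//.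
  apply: le_trans (modCD _ _) _; rewrite modCN modCX /modC ComplexField.Normc.normc1 -/(modC a).
  rewrite -[2]/(1 + 1 : R) lerD2l.
  by case/andP: a_lt1 => h1 h2; rewrite exprn_ile1 ?ltW.
by rewrite iter_Wcomp modCM modC_cexp ReD Re_natM ReD /s /z0 mulrA.
Qed.

Lemma entire_Wcomp f : entire f -> entire (T f).
Proof.
move=> /entire_cdiff df; apply/entire_cdiff => z.
have [l Hl] := df (a * z + b).
have Hw : cdiff_at (fun z => cexp (q * z + p)) z (cexp (q * z + p) * q).
  by apply: cdiff_affine; exact: cdiff_cexp.
have [m Hm] := cdiffM Hw (cdiff_affine Hl).
exists m; apply: cdiff_eq_near Hm; first exact: ltr01.
by move=> h _; rewrite /T /Wcomp [p + _]addrC.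
Qed.

Lemma entire_iter n f : entire f -> entire (iter n T f).
Proof.
move=> ef; elim: n => [|n IH]; first exact: ef.
by rewrite iterS; exact: entire_Wcomp IH.
Qed.

(** * Uniform upper bounds for the iterates *)

Lemma quadratic_absorb (k B D t : R) : 0 < k -> B * t + D <= k * t ^+ 2 + (D + B ^+ 2 / (4 * k)).
Proof.
move=> k0; rewrite -subr_ge0.
have -> : k * t ^+ 2 + (D + B ^+ 2 / (4 * k)) - (B * t + D) = k * (t - B / (2 * k)) ^+ 2.
  by field; rewrite gt_eqF.
by rewrite mulr_ge0 ?sqr_ge0// ltW.
Qed.

(** [A] and [c] are chosen before [f] and [n], which makes the domination uniform. The term
    [n%:R * s] is nonpositive and is dropped, and [pointwise_bound] is applied at the contracted
    point. *)
Lemma iter_growth : s <= 0 -> exists A c : R, 0 < c /\ forall nu f N n z, 1 <= nu ->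
  entire f -> 0 <= N -> (fint nu f <= N%:E)%E -> (1 <= n)%N ->
  modC (iter n T f z) <= (4 * (5 + N) * expR A) * expR (modC z ^+ 2 / 2 - c * modC z ^+ 2).
Proof.
move=> s0; pose r := modC a; pose d := modC z0; pose e := d + r * d + 4.
(* The contraction leaves [r ^+ 2 * t ^+ 2 / 2] in the exponent, short of [t ^+ 2 / 2] by
   [2 * c * t ^+ 2]: half of this gap absorbs the linear term [B * t], the other half is the
   gain. *)
pose c := (1 - r ^+ 2) / 4; pose B := K + r * e; pose D := K * d + e ^+ 2 / 2.
have /andP[r0 r1] : 0 < r < 1 by [].
have d0 : 0 <= d by exact: modC_ge0.
have c0 : 0 < c by rewrite divr_gt0// subr_gt0 expr_lt1// ltW.
exists (D + B ^+ 2 / (4 * c)), c; split=> // nu f N n z nu1 ef N0 fN n1.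
have [k hk ->] := modC_iter n f z.
set y := z0 + _; set t := modC z.
have t0 : 0 <= t by exact: modC_ge0.
have zz : modC (z - z0) <= t + d by apply: le_trans (modCD _ _) _; rewrite modCN.
have hy : modC y <= d + r * (t + d).
  apply: le_trans (modCD _ _) _; rewrite lerD2l modCM modCX; apply: ler_pM => //.
  - by rewrite exprn_ge0// modC_ge0.
  - exact: modC_ge0.
  (* [1 <= n] gives [r ^+ n <= r]; at [n = 0] there would be no contraction. *)
  - by case: n n1 {hk y} => // n _; rewrite exprS ger_pMr// exprn_ile1// ltW.
apply: le_trans (_ : expR (K * (t + d)) * (4 * (5 + N) * expR ((d + r * (t + d) + 4) ^+ 2 / 2)) <= _).
  apply: ler_pM; rewrite ?expR_ge0 ?modC_ge0//.
    rewrite ler_expR; apply: le_trans (_ : 0 + k <= _).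
      by rewrite lerD2r mulr_ge0_le0.
    rewrite add0r; apply: le_trans (ler_norm _) _; apply: le_trans hk _.
    by rewrite ler_wpM2l.
  apply: le_trans (pointwise_bound y nu1 ef fN) _.
  rewrite ler_wpM2l ?mulr_ge0 ?addr_ge0// ler_expR ler_pM2r ?invr_gt0//.
  rewrite ler_sqr ?nnegrE ?lerD2r// ?addr_ge0 ?modC_ge0// mulr_ge0 ?addr_ge0//.
  exact: ltW.
rewrite mulrCA -mulrA ler_wpM2l ?mulr_ge0 ?addr_ge0// -!expRD ler_expR.
have := quadratic_absorb B D t c0.
have -> : K * (t + d) + (d + r * (t + d) + 4) ^+ 2 / 2 = B * t + D + r ^+ 2 * t ^+ 2 / 2.
  by rewrite /B /D /e; field.
have -> : t ^+ 2 / 2 = 2 * c * t ^+ 2 + r ^+ 2 * t ^+ 2 / 2 by rewrite /c; field.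
lra.
Qed.

(** The bound [M] depends on [f] only through [N]. This serves a single [f], to see that the
    operator preserves the space, as well as the whole unit ball. *)
Lemma iter_fock_norm nu : 1 <= nu -> s <= 0 -> forall N : R, 0 <= N -> exists M : R,
  forall f n, entire f -> (fint nu f <= N%:E)%E -> (1 <= n)%N ->
  (fock_norm nu (iter n T f) <= M%:E)%E.
Proof.
move=> nu1 s0 N N0; have nu0 : 0 < nu by apply: lt_le_trans nu1.
have [A [c [c0 H]]] := iter_growth s0.
have [G [G0 HG]] := gauss_plane (mulr_gt0 nu0 c0).
exists ((nu / (2 * pi) * ((4 * (5 + N) * expR A) `^ nu * G)) `^ nu^-1).
move=> f n ef fN n1; apply: fock_norm_le => //; apply: fint_le_gauss HG.
- exact: ltW.
- by rewrite !mulr_ge0 ?addr_ge0 ?expR_ge0.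
- by apply: cdiff_cont; apply/entire_cdiff; exact: entire_iter.
- by move=> z; apply: H nu1 ef N0 fN n1.
Qed.

Lemma power_bounded_Wcomp nu : 1 <= nu -> s <= 0 -> power_bounded nu T.
Proof.
move=> nu1 s0; have nu0 : 0 < nu by apply: lt_le_trans nu1.
split.
  move=> f [ef nf]; split; first exact: entire_Wcomp.
  have [N N0 NE] := fint_fin nu0 nf.
  have [M HM] := iter_fock_norm nu1 s0 N0.
  have := HM f 1%N ef; rewrite NE lexx => /(_ isT isT) /le_lt_trans; apply.
  exact: ltry.
(* By [fint_le_of_norm] this number bounds [fint] on the unit ball. *)
have N0 : 0 <= (1 `^ nu / (nu / (2 * pi))) :> R.
  by rewrite divr_ge0 ?powR_ge0// ltW// fock_cst_gt0.
have [M HM] := iter_fock_norm nu1 s0 N0.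
exists M => n n1; apply: ge_ereal_sup => _ /= [f [[ef _] f1] <-].
by apply: HM => //; exact: fint_le_of_norm.
Qed.

(** * Lower bounds and failure of power-boundedness *)

Lemma small_const_in_fock nu : 1 <= nu -> exists c : R, [/\ 0 < c,
  in_fock nu (fun=> c%:C%C) & (fock_norm nu (fun=> c%:C%C) <= 1)%E].
Proof.
move=> nu1; have nu0 : 0 < nu by apply: lt_le_trans nu1.
(* At rate 1/2 the exponent in the hypothesis of [fint_le_gauss] vanishes, so that the lemma applies
   to a constant function. *)
have h2 : 0 < 2^-1 :> R by rewrite invr_gt0.
have [G [G0 HG]] := gauss_plane (mulr_gt0 nu0 h2).
pose k := nu / (2 * pi); have k0 : 0 < k by exact: fock_cst_gt0.
have kG : 0 < k * G + 1 by rewrite ltr_wpDl// mulr_ge0// ltW.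
(* The power [nu] of [c] is [1 / (k * G + 1)], which brings the norm down to at most 1; the added 1
   makes the denominator positive, [G] being known only as nonnegative. *)
pose c := (k * G + 1)^-1 `^ nu^-1.
have c0 : 0 < c by rewrite powR_gt0// invr_gt0.
have ec : entire (fun=> c%:C%C : C).
  by apply/entire_cdiff => z; exists 0; exact: cdiff_cst.
have nc : (fock_norm nu (fun=> c%:C%C) <= 1)%E.
  have H : (fint nu (fun=> c%:C%C) <= (c `^ nu * G)%:E)%E.
    apply: fint_le_gauss HG; [exact: ltW|exact: ltW| |].
    - by apply: cdiff_cont => z; exists 0; exact: cdiff_cst.
    - move=> z; rewrite modC_real gtr0_norm// ler_peMr ?(ltW c0)//.
      by rewrite (_ : _ - _ = 0) ?expR0//; field.
  apply: le_trans (fock_norm_le nu0 H) _; rewrite lee_fin.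
  have one : 1 `^ nu^-1 = 1 :> R by rewrite powR1.
  rewrite -[leRHS]one; apply: ge0_ler_powR.
  - by rewrite invr_ge0 ltW.
  - by rewrite nnegrE mulr_ge0 ?(ltW k0)// mulr_ge0// powR_ge0.
  - by rewrite nnegrE.
  rewrite /c -powRrM mulVf ?gt_eqF// powRr1 ?invr_ge0 ?(ltW kG)//.
  by rewrite mulrCA -/k mulrC ler_pdivrMr// mul1r lerDl.
exists c; split=> //; split=> //; apply: le_lt_trans nc _; exact: ltry.
Qed.

Lemma integral_unit_square (x y v : R) :
  (\int[areaC]_(_ in `[x, (x + 1)%R] `*` `[y, (y + 1)%R]) v%:E = v%:E)%E.
Proof.
have I1 (u : R) : lebesgue_measure `[u, u + 1] = 1%:E :> \bar R.
  by rewrite lebesgue_measure_itv/= lte_fin ltrDl ltr01 -EFinD addrAC subrr add0r.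
rewrite integral_cst; last exact: measurableX.
rewrite -[RHS]mule1; congr (_ * _)%E; transitivity (1%:E * 1%:E : \bar R)%E; last exact: mule1.
etransitivity; first by apply: product_measure1E; exact: measurable_itv.
by congr (_ * _)%E; exact: I1.
Qed.

(** On the unit square with lower left corner [z0] one has [modC (z - z0) <= 2], which bounds below
    both the modulus of the iterate, by [expR (n%:R * s) * c1], and the Gaussian weight, by [w]. The
    change of argument does not affect a constant function. *)
Lemma iter_const_lower nu (c : R) : 1 <= nu -> 0 < c -> exists L : R, 0 < L /\
  forall n, ((expR (n%:R * s) * L)%:E <= fock_norm nu (iter n T (fun=> c%:C%C)))%E.
Proof.
move=> nu1 c0; have nu0 : 0 < nu by apply: lt_le_trans nu1.
pose k := nu / (2 * pi); have k0 : 0 < k by exact: fock_cst_gt0.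
pose d := modC z0; pose w := expR (- nu * (d + 2) ^+ 2 / 2).
have w0 : 0 < w by exact: expR_gt0.
pose c1 := expR (- (K * 2)) * c; have c10 : 0 < c1 by rewrite mulr_gt0 ?expR_gt0.
exists (c1 * (k * w) `^ nu^-1); split; first by rewrite mulr_gt0// powR_gt0// mulr_gt0.
move=> n; set E := expR (n%:R * s); have E0 : 0 < E by exact: expR_gt0.
set h := iter n T _.
have ch : ccont h.
  apply: cdiff_cont; apply/entire_cdiff; apply: entire_iter.
  by apply/entire_cdiff => z; exists 0; exact: cdiff_cst.
pose x0 := complex.Re z0; pose y0 := complex.Im z0.
pose Q : set (R * R) := `[x0, x0 + 1] `*` `[y0, y0 + 1].
have mQ : measurable Q by exact: measurableX.
have low : (((E * c1) `^ nu * w)%:E <= fint nu h)%E.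
  apply: (@le_trans _ _ (\int[areaC]_(xy in Q) ((E * c1) `^ nu * w)%:E)%E).
    by rewrite integral_unit_square.
  apply: (@le_trans _ _ (\int[areaC]_(xy in Q) (fdens nu h xy)%:E)%E).
    apply: ge0_le_integral => //.
    - by move=> xy _; rewrite lee_fin mulr_ge0 ?powR_ge0 ?(ltW w0).
    - by apply: measurable_funTS; apply/measurable_EFinP; exact: measurable_fdens.
    move=> [x y] [/=]; rewrite !in_itv/= => /andP[hx1 hx2] /andP[hy1 hy2].
    rewrite lee_fin /fdens; cbn [fst snd].
    have zz : modC ((x +i* y)%C - z0) <= 2.
      have -> : (x +i* y)%C - z0 = ((x - x0) +i* (y - y0))%C.
        by apply: complex_ext; [rewrite -ReB|rewrite -ImB].
      apply: le_trans (modC_le_add _ _) _.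
      have -> : 2 = 1 + 1 :> R by ring.
      by apply: lerD; rewrite ler_norml; lra.
    apply: ler_pM; rewrite ?powR_ge0 ?expR_ge0//.
      apply: ge0_ler_powR; [exact: ltW|by rewrite nnegrE mulr_ge0 ?ltW|by rewrite nnegrE modC_ge0|].
      have [j hj ->] := modC_iter n (fun=> c%:C%C) (x +i* y)%C.
      rewrite modC_real gtr0_norm// /c1 mulrA ler_wpM2r ?(ltW c0)// expRD.
      rewrite ler_wpM2l ?expR_ge0// ler_expR.
      have : K * modC ((x +i* y)%C - z0) <= K * 2 by rewrite ler_wpM2l.
      by move: hj; rewrite ler_norml => /andP[hj _]; lra.
    rewrite ler_expR ler_pM2r ?invr_gt0// !mulNr lerN2 ler_wpM2l ?(ltW nu0)//.
    rewrite ler_sqr ?nnegrE ?addr_ge0 ?modC_ge0//.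
    rewrite -[(x +i* y)%C](subrK z0) addrC; apply: le_trans (modCD _ _) _.
    by rewrite lerD2l.
  apply: ge0_subset_integral => //.
    by apply/measurable_EFinP; exact: measurable_fdens.
  by move=> xy _; rewrite lee_fin fdens_ge0.
rewrite fock_normE.
(* [E] enters the density to the power [nu] and comes out of the root of order [nu] with exponent
   1. *)
have -> : E * (c1 * (k * w) `^ nu^-1) = (k * ((E * c1) `^ nu * w)) `^ nu^-1.
  have Ec : 0 <= E * c1 by rewrite mulr_ge0// ltW.
  have kw : 0 <= k * w by rewrite mulr_ge0// ltW.
  transitivity (((E * c1) `^ nu * (k * w)) `^ nu^-1); last by congr (_ `^ _); ring.
  rewrite (@powRM _ ((E * c1) `^ nu) (k * w)) ?powR_ge0// -powRrM mulfV ?gt_eqF//.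
  by rewrite powRr1// mulrA.
rewrite -poweR_EFin EFinM; apply: gt0_ler_poweR.
- by rewrite invr_ge0 ltW.
- rewrite in_itv/= leey andbT; apply: mule_ge0; rewrite lee_fin; first exact: ltW.
  by rewrite mulr_ge0 ?powR_ge0 ?(ltW w0).
- by rewrite in_itv/= leey andbT mule_ge0 ?fint_ge0// lee_fin ltW.
- by apply: lee_wpmul2l => //; rewrite lee_fin ltW.
Qed.

Lemma not_power_bounded_Wcomp nu : 1 <= nu -> 0 < s -> ~ power_bounded nu T.
Proof.
move=> nu1 s0 [_ [M HM]].
have [c [c0 cf c1]] := small_const_in_fock nu1.
have [L [L0 HL]] := iter_const_lower nu1 c0.
(* By [expR x >= 1 + x] the growth is at least linear in [n], which the Archimedean property turns
   into a contradiction. *)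
have low n : (1 <= n)%N -> (1 + n%:R * s) * L <= M.
  move=> n1; apply: (@le_trans _ _ (expR (n%:R * s) * L)).
    by rewrite ler_wpM2r ?(ltW L0)// expR_ge1Dx.
  rewrite -lee_fin; apply: le_trans (HL n) _; apply: le_trans (HM n n1).
  by apply: ereal_sup_ubound; exists (fun=> c%:C%C).
(* Exceeds [M / (s * L)]; the successor also ensures [1 <= n]. *)
pose n := (Num.bound `|M / (s * L)|).+1.
have sL : 0 < s * L by exact: mulr_gt0.
have := low n isT; apply/negP; rewrite -ltNge.
apply: (@le_lt_trans _ _ (`|M / (s * L)| * (s * L))).
  by rewrite -ler_pdivrMr// ler_norm.
apply: (@lt_le_trans _ _ (n%:R * (s * L))).
  rewrite ltr_pM2r//; apply: lt_trans (archi_boundP (normr_ge0 _)) _.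
  by rewrite ltr_nat.
have -> : (1 + n%:R * s) * L = L + n%:R * (s * L) by ring.
by rewrite lerDr ltW.
Qed.

End WeightedComposition.

Theorem theorem3p3 (R : realType) (nu : R) (a b p q : R[i]) :
  1 <= nu -> 0 < modC a < 1 ->
  (0 < complex.Re p + complex.Re (q * b / (1 - a)) ->
     ~ power_bounded nu (Wcomp (fun z => cexp (p + q * z)) (fun z => a * z + b))) /\
  (complex.Re p + complex.Re (q * b / (1 - a)) - ln (modC a) < 0 ->
     power_bounded nu (Wcomp (fun z => cexp (p + q * z)) (fun z => a * z + b))).
Proof.
move=> nu1 ha; split=> hs; first exact: not_power_bounded_Wcomp.
apply: power_bounded_Wcomp => //.
(* From [ln (modC a) < 0] the hypothesis makes the growth exponent negative. *)
by have := ln_lt0 ha; lra.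
Qed.
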